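(* Let $n\ge 1$ and $d\ge 1$ be integers. Let $A_1,\dots,A_n:\mathbb{R}^d\rightrightarrows\mathbb{R}^d$ be maximal monotone operators, and let $B:\mathbb{R}^d\to\mathbb{R}^d$ be monotone and $L$-Lipschitz continuous for some $L>0$. Assume the inclusion $0\in\sum_{i=1}^n A_i(z)+B(z)$ has at least one solution $z\in\mathbb{R}^d$. Run Algorithm SPS (described in the context) with $\tau>0$, an initial point $p^1=(z^1,w_1^1,\dots,w_{n+1}^1)\in\mathbb{R}^{(n+2)d}$ satisfying $\sum_{i=1}^{n+1}w_i^1=0$, and deterministic stepsizes $\alpha_k>0,\rho_k>0$. Suppose the noise terms satisfy, almost surely for every $k$, $$\mathbb{E}[\epsilon^k\mid\mathcal{F}_k]=0,\quad \mathbb{E}[e^k\mid\mathcal{F}_k]=0,$$ $$\mathbb{E}[\|\epsilon^k\|^2\mid\mathcal{F}_k]\le N_1+N_2\|B(z^k)\|^2,\qquad \mathbb{E}[\|e^k\|^2\mid\mathcal{F}_k,\mathcal{E}_k]\le N_3+N_4\|B(x_{n+1}^k)\|^2,$$ for constants $0\le N_1,N_2,N_3,N_4<\infty$, and suppose the stepsizes satisfy $$\sum_{k=1}^\infty\alpha_k\rho_k=\infty,\quad \sum_{k=1}^\infty\alpha_k^2<\infty,\quad \sum_{k=1}^\infty\alpha_k\rho_k^2<\infty,\quad \rho_k\le\bar\rho<\frac1L\ \text{ for all }k,$$ for some constant $\bar\rho$. Then with probability one, $z^k\to z^*$ for some (random) $z^*$ satisfying $0\in\sum_{i=1}^n A_i(z^*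 )+B(z^* )$.
   Context: For a maximal monotone $A$ and $\tau>0$, the resolvent is $J_{\tau A}=(I+\tau A)^{-1}$, which is single-valued with domain $\mathbb{R}^d$. Algorithm SPS (Stochastic Projective Splitting): given $p^k=(z^k,w_1^k,\dots,w_{n+1}^k)$, for $i=1,\dots,n$ set $t_i^k=z^k+\tau w_i^k$, $x_i^k=J_{\tau A_i}(t_i^k)$, $y_i^k=\tau^{-1}(t_i^k-x_i^k)$. Then set $r^k=B(z^k)+\epsilon^k$, $x_{n+1}^k=z^k-\rho_k(r^k-w_{n+1}^k)$, $y_{n+1}^k=B(x_{n+1}^k)+e^k$, where $\epsilon^k,e^k$ are $\mathbb{R}^d$-valued random variables (unknown noise of a stochastic oracle for $B$) on a probability space $(\Omega,\mathcal{F},P)$. Finally set $z^{k+1}=z^k-\alpha_k\sum_{i=1}^{n+1}y_i^k$ and $w_i^{k+1}=w_i^k-\alpha_k\big(x_i^k-\frac{1}{n+1}\sum_{j=1}^{n+1}x_j^k\big)$ for $i=1,\dots,n+1$. Here $\mathcal{F}_k=\sigma(p^1,\dots,p^k)$ and $\mathcal{E}_k=\sigma(\epsilon^k)$; $\epsilon^k$ and $e^k$ need not be independent. *)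

(* Defs.v *)
From HB Require Import structures.
From mathcomp Require Import all_boot all_order all_algebra.
From mathcomp Require Import all_classical all_reals all_analysis.
From mathcomp Require Import measurable_realfun matrix_topology matrix_normedtype.
Set Implicit Arguments. Unset Strict Implicit. Unset Printing Implicit Defensive.
Import Order.TTheory GRing.Theory Num.Theory.
Local Open Scope classical_set_scope.
Local Open Scope ring_scope.

Definition dotp {R : realType} {d : nat} (u v : 'rV[R]_d) : R :=
  \sum_(i < d) u ord0 i * v ord0 i.
Definition enorm {R : realType} {d : nat} (u : 'rV[R]_d) : R :=
  Num.sqrt (dotp u u).

Definition monotone_op {R : realType} {d : nat} (A : 'rV[R]_d -> set 'rV[R]_d) :=
  forall x y u v, A x u -> A y v -> 0 <= dotp (u - v) (x - y).

Definition maximal_monotone {R : realType} {d : nat}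
  (A : 'rV[R]_d -> set 'rV[R]_d) :=
  monotone_op A /\
  forall A' : 'rV[R]_d -> set 'rV[R]_d,
    monotone_op A' -> (forall x, A x `<=` A' x) -> A' = A.

Definition monotone_fun {R : realType} {d : nat} (B : 'rV[R]_d -> 'rV[R]_d) :=
  forall x y, 0 <= dotp (B x - B y) (x - y).

Definition lipschitz_with {R : realType} {d : nat} (L : R)
  (B : 'rV[R]_d -> 'rV[R]_d) :=
  forall x y, enorm (B x - B y) <= L * enorm (x - y).

(** [resolvent_rel tau A t x] : x ∈ (I + tau A)^{-1}(t), i.e. t ∈ x + tau A(x).
    (For maximal monotone A this determines x = J_{tau A}(t) uniquely.) *)
Definition resolvent_rel {R : realType} {d : nat} (tau : R)
  (A : 'rV[R]_d -> set 'rV[R]_d) (t x : 'rV[R]_d) :=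
  exists a, A x a /\ t = x + tau *: a.

Definition is_zero_of_sum {R : realType} {d n : nat}
  (A : 'I_n -> 'rV[R]_d -> set 'rV[R]_d) (B : 'rV[R]_d -> 'rV[R]_d)
  (z : 'rV[R]_d) :=
  exists a : 'I_n -> 'rV[R]_d, (forall i, A i z (a i)) /\ \sum_(i < n) a i + B z = 0.

Section Prob.
Context {dT : measure_display} {T : measurableType dT} {R : realType}.

Definition gen_sigma (fs : set (T -> R)) : set (set T) :=
  <<s [set A | exists f, fs f /\ exists B : set R, measurable B /\ A = f @^-1` B] >>.

Definition gen_sigma_vec {d : nat} (Xs : set (T -> 'rV[R]_d)) : set (set T) :=
  gen_sigma [set f | exists X, Xs X /\ exists c : 'I_d, f = fun w => X w ord0 c].

Definition is_cond_exp (P : probability T R) (G : set (set T)) (X Y : T -> R) :=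
  (forall B : set R, measurable B -> G (Y @^-1` B)) /\
  P.-integrable setT (EFin \o X) /\ P.-integrable setT (EFin \o Y) /\
  forall A, G A -> (\int[P]_(w in A) (X w)%:E = \int[P]_(w in A) (Y w)%:E)%E.

Definition is_cond_exp_nonneg (P : probability T R) (G : set (set T))
  (X Y : T -> \bar R) :=
  (forall B : set (\bar R), measurable B -> G (Y @^-1` B)) /\
  (forall w, (0 <= Y w)%E) /\
  forall A, G A -> (\int[P]_(w in A) X w = \int[P]_(w in A) Y w)%E.

Definition cond_mean_zero {d : nat} (P : probability T R) (G : set (set T))
  (X : T -> 'rV[R]_d) :=
  forall c : 'I_d, is_cond_exp P G (fun w => X w ord0 c) (fun _ => 0).

Definition cond_sq_bound {d : nat} (P : probability T R) (G : set (set T))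
  (X : T -> 'rV[R]_d) (U : T -> R) :=
  exists Y, is_cond_exp_nonneg P G (fun w => ((enorm (X w)) ^+ 2)%:E) Y /\
    {ae P, forall w, (Y w <= (U w)%:E)%E}.

Definition random_vector {d : nat} (X : T -> 'rV[R]_d) :=
  forall c : 'I_d, measurable_fun setT (fun w => X w ord0 c).

End Prob.

(** Convergence of a sequence of vectors in R^d (product = Euclidean topology).
    (R^o is R, viewed with its canonical normed/topological structure.) *)
Definition cvg_vec {R : realType} {d : nat} (u : nat -> 'rV[R]_d) (l : 'rV[R]_d) :=
  (u : nat -> 'rV[R^o]_d) @ \oo --> (l : 'rV[R^o]_d).

(* Main.v *)
(* Let [ps = (zs, ws)] run over the extended solutions: [ws_i] in [A_i zs],
   [ws_(n+1) = B zs], [sum_i ws_i = 0]. Each step of the algorithm is a gradient step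
   for an affine function separating the iterate [p^k] from all the [ps]. Monotonicity
   and [rho_k <= rhobar < 1/L] give, for [W_k = 1 + |p^k - ps|^2] and the residual
   [Theta_k = sum_i |z^k - x_i^k|^2 + |B z^k - w_(n+1)^k|^2],
     [E[W_(k+1) | F_k] + 2 kappa alpha_k rho_k Theta_k
        <= (1 + K (alpha_k^2 + alpha_k rho_k^2)) W_k].
   The factor is deterministic with a convergent infinite product, so [W_k] is a
   supermartingale up to normalisation and converges almost surely by Doob's upcrossing
   argument, while [sum_k alpha_k rho_k = oo] forces [liminf Theta_k = 0]. This holds
   simultaneously for a countable dense family of extended solutions. Pathwise, a cluster
   point of [p^k] along a filter on which [Theta_k] vanishes is an extended solution
   because maximal monotone graphs are closed; approximating it by the dense family
   shows that the whole sequence converges to it.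
   Conditional expectations never appear: every inequality given [F_k] is stated as an
   inequality between integrals over the events of [F_k]. *)
Require Import Defs.
From HB Require Import structures.
From mathcomp Require Import all_boot all_order all_algebra.
From mathcomp Require Import all_classical all_reals all_analysis.
From mathcomp Require Import measurable_realfun matrix_topology matrix_normedtype.
From mathcomp Require Import ring lra.
Import Order.TTheory GRing.Theory Num.Theory.
Import numFieldNormedType.Exports.
Local Open Scope classical_set_scope.
Local Open Scope ring_scope.

(** * Convergence of nonnegative supermartingales *)

(** The recursion closes on [W_k] alone: resolvents and [B] are Lipschitz, the noise variances grow
    at most like |B|^2, and the 1 in [W_k] absorbs the constants [N1] and [N3]. Boundedness of the
    iterates is thus an outcome of the supermartingale argument. The two summability conditions play
    different roles. The squared length of the step costs alpha_k^2. Evaluating [B] at the noisy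
    point x_(n+1)^k costs L rho_k^2 |eps^k|^2 already at first order in alpha_k, hence alpha_k
    rho_k^2. Two obstacles shape the pathwise part. The null set outside which [W_k] converges
    depends on the solution, so only countably many solutions can be treated at once; and the
    cluster point, being random, need not be one of them. Moreover the residual is small only along
    some times, so the cluster point is found along those times, and the convergence of the
    distances to nearby solutions carries it over to all times. *)

(** The limit is the liminf, obtained as the infimum of the levels below which [u] falls infinitely
    often. Two rationals in []inf E, inf E + e[], the lower one such a level, turn the absence of
    oscillation into an eventual upper bound. *)
Lemma cvg_no_oscillation {R : realType} (u : nat -> R) (M : R) :
  (forall k, 0 <= u k) ->
  (forall N, exists2 k, (N <= k)%N & u k < M) ->
  (forall a b : rat, a < b -> (forall N, exists2 k, (N <= k)%N & u k < ratr a) ->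
    exists N, forall k, (N <= k)%N -> u k < ratr b) ->
  cvgn u.
Proof.
move=> u0 uM osc.
pose E := [set a | forall N, exists2 k, (N <= k)%N & u k < a].
have lbE : lbound E 0.
  by move=> a /(_ 0%N)[k _ uk]; apply: ltW; exact: le_lt_trans uk.
have infE : has_inf E by split; [exists M|exists 0].
apply/cvg_ex; exists (inf E); apply/cvgrPdist_lt => e e0.
have [r rE re] : exists2 r, E (ratr r) & ratr r < inf E + e.
  have [a Ea ae] := inf_adherent e0 infE.
  have [r /andP[/= ar re]] := rat_in_itvoo ae.
  exists r => // N; have [k Nk uk] := Ea N; exists k => //.
  exact: lt_trans ar.
have [s /andP[/= rs se]] := rat_in_itvoo re.
rewrite bnd_simp ltr_rat in rs; rewrite bnd_simp in se.
have [N1 h1] := osc r s rs rE.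
have [N2 h2] : exists N, forall k, (N <= k)%N -> inf E - e / 2 <= u k.
  apply: contrapT => h.
  have : E (inf E - e / 2).
    move=> N; apply: contrapT => hN; apply: h; exists N => k Nk.
    by rewrite leNgt; apply/negP => uk; apply: hN; exists k.
  move=> /(ge_inf infE.2); lra.
exists (maxn N1 N2) => // k /=; rewrite geq_max => /andP[/h1 u1 /h2 u2].
rewrite ltr_distlC; apply/andP; split; lra.
Qed.

Section Upcrossing.
Context {d : measure_display} {T : measurableType d} {R : realType}.
Variables (P : probability T R) (G : nat -> set (set T)) (U : nat -> T -> R).
Hypothesis G_measurable : forall k, (G k).-sigma.-measurable `<=` @measurable d T.
Hypothesis G_nondecreasing : forall k,
  (G k).-sigma.-measurable `<=` (G k.+1).-sigma.-measurable.
Hypothesis U_adapted : forall k,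
  measurable_fun [set: g_sigma_algebraType (G k)] (U k).
Hypothesis U_ge0 : forall k x, 0 <= U k x.
Hypothesis U_integrable : forall k, P.-integrable setT (EFin \o U k).
Hypothesis U_super : forall k A, (G k).-sigma.-measurable A ->
  \int[P]_(x in A) U k.+1 x <= \int[P]_(x in A) U k x.

Let mU_lt k a : (G k).-sigma.-measurable [set x | U k x < a].
Proof.
have := @measurable_fun_ltr _ (g_sigma_algebraType (G k)) _ setT (U k) (cst a)
  (U_adapted k) (measurable_cst _).
by move=> /(_ measurableT [set true] I); rewrite setTI.
Qed.

Let U_intS k A : measurable A -> P.-integrable A (EFin \o U k).
Proof. by move=> mA; apply: integrableS (U_integrable k). Qed.

(* [holding a b k] is the event that an upcrossing of [a, b] is under way. *)
Fixpoint holding (a b : R) k : set T :=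
  if k is k'.+1 then
    (holding a b k' `&` [set x | U k x < b]) `|`
    (~` holding a b k' `&` [set x | U k x < a])
  else [set x | U 0 x < a].

(** The upcrossing under way at time [k] is completed at time [k.+1]; the index is the last time of
    holding. *)
Definition upcrossed a b k := holding a b k `&` ~` [set x | U k.+1 x < b].

Let m_holding a b k : (G k).-sigma.-measurable (holding a b k).
Proof.
elim: k => [|k IH] /=; first exact: mU_lt.
apply: (@measurableU _ (g_sigma_algebraType (G k.+1))).
  apply: (@measurableI _ (g_sigma_algebraType (G k.+1))); last exact: mU_lt.
  exact: G_nondecreasing.
apply: (@measurableI _ (g_sigma_algebraType (G k.+1))); last exact: mU_lt.
by apply: (@measurableC _ (g_sigma_algebraType (G k.+1))); exact: G_nondecreasing.
Qed.

Lemma measurable_upcrossed a b k : measurable (upcrossed a b k).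
Proof.
apply: measurableI; first exact: G_measurable (m_holding _ _ _).
by apply: measurableC; apply: G_measurable (mU_lt _ _).
Qed.

(** Doob's argument as an invariant: a share is bought below [a], held while [holding], and sold at
    [b] or more on [upcrossed]. The supermartingale property on [H], which splits into the shares
    still held [H1] and those sold [D], pays [b - a] for each sale; the new purchases [H2] cost at
    most [a] each. *)
Lemma upcrossing_bound a b k : 0 <= a -> a < b ->
  \int[P]_(x in holding a b k) U k x
    + (b - a) * \sum_(0 <= j < k) fine (P (upcrossed a b j))
  <= a * fine (P (holding a b k)).
Proof.
move=> a0 ab.
have mH j : measurable (holding a b j) by exact: G_measurable (m_holding _ _ _).
have mL j c : measurable [set x | U j x < c] by exact: G_measurable (mU_lt _ _).
have int_cst A c : measurable A -> P.-integrable A (EFin \o cst c).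
  by move=> mA; exact: finite_measure_integrable_cst.
have le_cst A j c : measurable A -> (forall x, A x -> U j x <= c) ->
    \int[P]_(x in A) U j x <= c * fine (P A).
  move=> mA Uc; rewrite -Rintegral_cst//.
  by apply: le_Rintegral => //; [exact: U_intS|exact: int_cst].
have ge_cst A j c : measurable A -> (forall x, A x -> c <= U j x) ->
    c * fine (P A) <= \int[P]_(x in A) U j x.
  move=> mA Uc; rewrite -Rintegral_cst//.
  by apply: le_Rintegral => //; [exact: int_cst|exact: U_intS].
have fineU A B : measurable A -> measurable B -> [disjoint A & B] ->
    fine (P (A `|` B)) = fine (P A) + fine (P B).
  move=> mA mB /disj_setPS dAB.
  have AB0 : A `&` B = set0 by rewrite -subset0.
  by rewrite measureU// fineD//; exact: fin_num_measure.
elim: k => [|k IH].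
  rewrite big_geq// mulr0 addr0; apply: le_cst => // x /=; exact: ltW.
rewrite big_nat_recr//= mulrDr.
set S := \sum_(_ <= _ < _) _ in IH *.
pose H := holding a b k.
pose H1 := H `&` [set x | U k.+1 x < b].
pose D := upcrossed a b k.
pose H2 := ~` H `&` [set x | U k.+1 x < a].
have mH1 : measurable H1 := measurableI _ _ (mH k) (mL k.+1 b).
have mD : measurable D := measurable_upcrossed a b k.
have mH2 : measurable H2 := measurableI _ _ (measurableC (mH k)) (mL k.+1 a).
have HE : H = H1 `|` D by rewrite /H1 /D /upcrossed -setIUr setUv setIT.
have dH1D : [disjoint H1 & D] by apply/disj_setPS => x [[_ ?] [_]].
have dH12 : [disjoint H1 & H2] by apply/disj_setPS => x [[? _] []].
rewrite -/H -/H1 -/H2 Rintegral_setU//; last by apply: U_intS; exact: measurableU.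
have IU := @U_super k H (m_holding a b k).
have := IH; rewrite -/H {2}HE fineU// => {}IH.
have I1 : \int[P]_(x in H) U k.+1 x =
    \int[P]_(x in H1) U k.+1 x + \int[P]_(x in D) U k.+1 x.
  by rewrite HE Rintegral_setU//; apply: U_intS; exact: measurableU.
have ID : b * fine (P D) <= \int[P]_(x in D) U k.+1 x.
  by apply: ge_cst => // x [_ /= /negP]; rewrite -leNgt.
have I2 : \int[P]_(x in H2) U k.+1 x <= a * fine (P H2).
  by apply: le_cst => // x [_ /=]; exact: ltW.
rewrite fineU// -/D; lra.
Qed.

(** The held shares have nonnegative value, so the expected number of upcrossings is at most
    [a / (b - a)] uniformly in time, and Borel-Cantelli applies. *)
Lemma upcrossed_finitely_often a b : 0 <= a -> a < b ->
  {ae P, forall x, exists N, forall k, (N <= k)%N -> ~ upcrossed a b k x}.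
Proof.
move=> a0 ab.
have mD := measurable_upcrossed a b.
exists (lim_sup_set (upcrossed a b)); split.
- apply: bigcap_measurable => // k _; exact: bigcup_measurable.
- apply: lim_sup_set_cvg0 => //.
  apply: (@le_lt_trans _ _ (a / (b - a))%:E); last exact: ltry.
  apply: lime_le; first exact: is_cvg_nneseries.
  apply: nearW => k.
  have -> : (\sum_(0 <= j < k) P (upcrossed a b j) =
      (\sum_(0 <= j < k) fine (P (upcrossed a b j)))%:E)%E.
    by rewrite -sumEFin; apply: eq_bigr => j _; rewrite fineK// fin_num_measure.
  rewrite lee_fin ler_pdivlMr ?subr_gt0// mulrC.
  have := upcrossing_bound a b k a0 ab.
  have : 0 <= \int[P]_(x in holding a b k) U k x by exact: Rintegral_ge0.
  have : fine (P (holding a b k)) <= 1.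
    have mH : measurable (holding a b k) by exact: G_measurable (m_holding _ _ _).
    by rewrite -lee_fin fineK ?fin_num_measure// probability_le1.
  nra.
- move=> x /= nD k _; apply: contrapT => h; apply: nD; exists k => j kj Dj.
  by apply: h; exists j.
Qed.

(** A fall below [a] after the last completed upcrossing starts one that never ends, which keeps [U]
    below [b] from then on. *)
Lemma no_oscillation (a b : R) x :
  (exists N, forall k, (N <= k)%N -> ~ upcrossed a b k x) -> a < b ->
  (forall N, exists2 k, (N <= k)%N & U k x < a) ->
  exists N, forall k, (N <= k)%N -> U k x < b.
Proof.
move=> [N hN] ab io.
have step k : (N <= k)%N -> holding a b k x -> U k.+1 x < b /\ holding a b k.+1 x.
  move=> Nk Hk; have := hN _ Nk.
  rewrite /upcrossed /= => /not_andP[//|/contrapT Ub]; split=> //; by left.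
have [k Nk Uk] := io N.+1.
have Hk : holding a b k x.
  case: k Nk Uk => // k Nk Uk /=.
  have [?|?] := pselect (holding a b k x); [left|right] => //; split=> //=.
  exact: lt_trans ab.
exists k => j /subnK <-.
suff [] : U (j - k + k)%N x < b /\ holding a b (j - k + k) x by [].
elim: (j - k)%N => [|m [_ IH]]; first by split=> //; exact: lt_trans ab.
rewrite addSn; apply: step => //.
by rewrite (leq_trans (ltnW Nk))// leq_addl.
Qed.

(** This excludes divergence to infinity, which the absence of upcrossings permits. By Fatou the
    liminf has integral at most that of [U 0], so it is finite almost everywhere. *)
Lemma frequently_bounded :
  {ae P, forall x, exists M, forall N, exists2 k, (N <= k)%N & U k x < M}.
Proof.
have mU k : measurable_fun setT (EFin \o U k) by apply: measurable_int (U_integrable k).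
pose f x := limn_einf (fun k => (U k x)%:E).
have f0 x : (0 <= f x)%E.
  rewrite /f limn_einf_lim; apply: lime_ge; first exact: is_cvg_einfs.
  by apply: nearW => N; apply: le_ereal_inf_tmp => _ [k /= _ <-]; rewrite lee_fin.
have mf : measurable_fun setT f.
  rewrite /f; under eq_fun do rewrite limn_einf_lim.
  apply: (@emeasurable_fun_cvg _ _ _ _ (fun N x => einfs (fun k => (U k x)%:E) N)).
    by move=> N; exact: measurable_fun_einfs.
  by move=> x _; exact: is_cvg_einfs.
have intf : P.-integrable setT f.
  apply/integrableP; split=> //.
  under eq_integral do rewrite gee0_abs//.
  apply: (@le_lt_trans _ _ (\int[P]_x U 0 x)%:E); last exact: ltry.
  apply: le_trans (fatou P measurableT mU _) _.
    by move=> k x _; rewrite lee_fin.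
  rewrite limn_einf_lim; apply: lime_le; first exact: is_cvg_einfs.
  apply: nearW => N.
  apply: (@le_trans _ _ (\int[P]_x (U N x)%:E)%E).
    by apply: ereal_inf_lbound; exists N => /=.
  rewrite -[leLHS]fineK; last exact: integrable_fin_num (U_integrable N).
  rewrite lee_fin; elim: N => // N; apply: le_trans.
  exact: U_super N setT (@measurableT _ (g_sigma_algebraType (G N))).
have := integrable_ae measurableT intf; apply: filterS => x /(_ I) fx.
exists (fine (f x) + 1) => N; apply: contrapT => h.
have : (f x < (fine (f x) + 1)%:E)%E by rewrite EFinD fineK// lteDl// lte_fin.
rewrite ltNge => /negP; apply.
rewrite /f limn_einf_lim; apply: lime_ge; first exact: is_cvg_einfs.
exists N => // m /= Nm; apply: le_ereal_inf_tmp => _ [k /= mk <-].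
rewrite lee_fin leNgt; apply/negP => Uk; apply: h; exists k.
  exact: leq_trans mk.
by rewrite /f limn_einf_lim.
Qed.

Theorem supermartingale_cvg : {ae P, forall x, cvgn (U ^~ x)}.
Proof.
(* The default pair (0, 0) fails [(ab n).1 < (ab n).2], so codes that decode to nothing impose no
   condition. *)
pose ab n : rat * rat := odflt (0, 0) (unpickle n).
have osc : {ae P, forall x, forall n, 0 <= (ab n).1 -> (ab n).1 < (ab n).2 ->
    exists N, forall k, (N <= k)%N -> ~ upcrossed (ratr (ab n).1) (ratr (ab n).2) k x}.
  apply: ae_foralln => n; have [[a0 ab_lt]|h] :=
    pselect (0 <= (ab n).1 /\ (ab n).1 < (ab n).2).
    have := upcrossed_finitely_often (ratr (ab n).1) (ratr (ab n).2).
    rewrite ler0q ltr_rat => /(_ a0 ab_lt); apply: filterS; exact.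
  by apply: filterE => x ? ?; case: h.
apply: filterS2 frequently_bounded osc => x [M bd] osc.
apply: (@cvg_no_oscillation _ _ M) => // a b altb io.
have a0 : 0 <= a.
  have [k _ Uk] := io 0%N.
  by rewrite -(ler0q R); apply: ltW; exact: le_lt_trans (U_ge0 k x) Uk.
have := osc (pickle (a, b)); rewrite /ab pickleK /= => /(_ a0 altb) hN.
apply: no_oscillation hN _ io; by rewrite ltr_rat.
Qed.
End Upcrossing.

(** * Measurability of Lipschitz images *)

(** The sequence must stay in [I], so rational points of R^J cannot serve themselves. For each
    rational centre and radius 1/(m+1) an index whose image lies in that ball is chosen, if there is
    one; radii below [e / 2] then give density. *)
Lemma dense_sequence {R : realType} {I : Type} {J : finType} (X : I -> J -> R)
    (i0 : I) :
  exists s : nat -> I, forall i e, 0 < e ->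
    exists k, forall j, `|X i j - X (s k) j| < e.
Proof.
pose near_pt (qm : {ffun J -> rat} * nat) i :=
  forall j, `|X i j - ratr (qm.1 j)| < qm.2.+1%:R^-1.
have /choice[f hf] qm : exists i, (exists i', near_pt qm i') -> near_pt qm i.
  by have [[i hi]|h] := pselect (exists i, near_pt qm i); [exists i|exists i0].
exists (fun k => if unpickle k is Some qm then f qm else i0) => i e e0.
have [m hm] : exists m : nat, m.+1%:R^-1 < e / 2.
  have [m _ hm] := near_infty_natSinv_lt (PosNum (divr_gt0 e0 (@ltr0Sn R 1))).
  by exists m; exact: (hm m (leqnn m)).
set c := m.+1%:R^-1 in hm; have c0 : 0 < c by rewrite invr_gt0 ltr0Sn.
have /choice[q hq] j : exists q, `|X i j - ratr q| < c.
  have m0 : X i j - c < X i j by lra.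
  have [r /andP[]] := rat_in_itvoo m0; rewrite !bnd_simp => r1 r2.
  by exists r; rewrite ger0_norm; lra.
have := hf ([ffun j => q j], m).
have nXi : near_pt ([ffun j => q j], m) i by move=> j /=; rewrite ffunE.
move=> /(_ (ex_intro _ i nXi)) hs.
exists (pickle ([ffun j => q j], m)) => j; rewrite pickleK.
have /= := nXi j; have /= := hs j; rewrite -/c.
rewrite !ltr_norml => /andP[? ?] /andP[? ?]; apply/andP; split; lra.
Qed.

(* [g] is the infimum of the cones [g (s k) + K * |X - X (s k)|] over a sequence [s] whose
   image is dense in that of [X]. Lipschitz continuity is only required between values
   of [X]: a resolvent is only known at the points where the algorithm evaluates it. *)
Lemma measurable_fun_lipschitz {d : measure_display} {S : measurableType d}
    {R : realType} {J : finType} (X : S -> J -> R) (g : S -> R) (K : R) :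
  (forall j, measurable_fun setT (X ^~ j)) ->
  (forall a b, `|g a - g b| <= K * \sum_j `|X a j - X b j|) ->
  measurable_fun setT g.
Proof.
move=> mX lip.
have [s hs] := dense_sequence X point.
pose h k a := g (s k) + K * \sum_j `|X a j - X (s k) j|.
have mh k : measurable_fun setT (h k).
  apply: measurable_funD => //; apply: measurable_funM => //.
  apply: measurable_sum => j; apply: measurableT_comp => //.
  exact: measurable_funB.
have gh a k : g a <= h k a.
  have := lip a (s k); rewrite ler_norml => /andP[_]; rewrite /h; lra.
have hg a e : 0 < e -> exists k, h k a < g a + e.
  move=> e0.
  (* The cone at [s k] exceeds [g a] by at most twice [K] times the distance: once for the slope,
     once for [g (s k) - g a]. The 1 keeps the denominator positive. *)
  pose c := (2 * `|K| * #|J|%:R + 1) ^-1 * e.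
  have D0 : 0 < 2 * `|K| * #|J|%:R + 1 by rewrite ltr_wpDl// !mulr_ge0.
  have c0 : 0 < c by rewrite mulr_gt0// invr_gt0.
  have [k hk] := hs a c c0; exists k.
  have S0 : 0 <= \sum_j `|X a j - X (s k) j| by apply: sumr_ge0.
  have Sc : \sum_j `|X a j - X (s k) j| <= #|J|%:R * c.
    rewrite mulr_natl -sumr_const; apply: ler_sum => j _; exact/ltW/hk.
  have KS : K * \sum_j `|X a j - X (s k) j| <= `|K| * (#|J|%:R * c).
    apply: (@le_trans _ _ (`|K| * \sum_j `|X a j - X (s k) j|)).
      by rewrite ler_wpM2r// ler_norm.
    by rewrite ler_wpM2l.
  have := lip a (s k); rewrite ler_norml => /andP[+ _].
  have : (2 * `|K| * #|J|%:R + 1) * c = e by rewrite /c mulrA divff ?mul1r// gt_eqF.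
  rewrite /h; lra.
apply: (measurability _ (RGenInftyO.measurableE R)) => //.
move=> _ [_ [r ->] <-]; rewrite setTI.
have -> : g @^-1` `]-oo, r[ = \bigcup_k [set a | h k a < r].
  apply/seteqP; split=> [a|a [k _]] /=; rewrite in_itv /=.
    rewrite -subr_gt0 => /(hg a)[k hk]; exists k => //=; lra.
  exact: le_lt_trans.
apply: bigcupT_measurable => k.
have := @measurable_fun_ltr _ _ _ setT (h k) (cst r) (mh k) (measurable_cst _).
by move=> /(_ measurableT [set true] I); rewrite setTI.
Qed.

(** * Variables orthogonal to a sub-sigma-algebra *)

Lemma le_Rintegrable {d : measure_display} {T : measurableType d} {R : realType}
    (mu : {measure set T -> \bar R}) (D : set T) (f g : T -> R) :
  measurable D -> measurable_fun D f -> mu.-integrable D (EFin \o g) ->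
  (forall x, D x -> `|f x| <= g x) -> mu.-integrable D (EFin \o f).
Proof.
move=> mD mf ig fg; apply: le_integrable ig => //; first exact/measurable_EFinP.
by move=> x Dx; rewrite /= lee_fin (le_trans (fg x Dx))// ler_norm.
Qed.

Section OrthogonalToSubalgebra.
Context {d : measure_display} {T : measurableType d} {R : realType}.
Variables (P : probability T R) (G : set (set T)) (X : T -> R).
Hypothesis G_measurable : G.-sigma.-measurable `<=` @measurable d T.
Hypothesis X_integrable : P.-integrable setT (EFin \o X).
Hypothesis X_orth : forall A, G.-sigma.-measurable A -> \int[P]_(x in A) X x = 0.

Import HBNNSimple.

Lemma sub_sigma_measurable_fun (f : T -> R) :
  measurable_fun [set: g_sigma_algebraType G] f -> measurable_fun [set: T] f.
Proof. by move=> mf _ B mB; apply: G_measurable; exact: mf. Qed.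

Let mX : measurable_fun setT X.
Proof. by apply/measurable_EFinP; exact: measurable_int X_integrable. Qed.

(** The level sets of [f] are events of [G], so [X] integrates to zero on their intersections with
    [A]. *)
Lemma orthogonal_nnsfun (f : {nnsfun (g_sigma_algebraType G) >-> R}) A :
  G.-sigma.-measurable A -> \int[P]_(x in A) (X x * f x) = 0.
Proof.
move=> GA.
have mA := G_measurable A GA.
have -> : \int[P]_(x in A) (X x * f x) = \int[P]_(x in A)
    \sum_(y <- finmap.enum_fset (fset_set (range f)))
      y * (X \_ (f @^-1` [set y])) x.
  apply: eq_Rintegral => x _; rewrite (fimfunE f) fsbig_finite//= mulr_sumr.
  apply: eq_bigr => y _; rewrite mulrCA; congr (_ * _).
  by rewrite indicE patchE; case: ifP => _; rewrite ?mulr1 ?mulr0.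
have my y : G.-sigma.-measurable (f @^-1` [set y]).
  by rewrite -[X in _.-measurable X]setTI; exact: (measurable_funP f).
have iX y : P.-integrable A (EFin \o (fun x => y * (X \_ (f @^-1` [set y])) x)).
  apply: (@integrableZl _ _ _ _ _ mA y (EFin \o (X \_ (f @^-1` [set y])))).
  rewrite -restrict_EFin; apply/integrable_restrict => //; first exact: G_measurable.
  by apply: integrableS X_integrable => //; apply: measurableI => //; exact: G_measurable.
elim: (finmap.enum_fset _) => [|y s IH].
  by under eq_Rintegral do rewrite big_nil; rewrite Rintegral_cst// mul0r.
under eq_Rintegral do rewrite big_cons.
rewrite RintegralD//; last first.
  rewrite (_ : _ \o _ = fun x => (\sum_(j <- s) (j * (X \_ (f @^-1` [set j])) x)%:E)%E).
    by apply: integrable_sum => // j _; exact: iX.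
  by apply/funext => x; rewrite /= sumEFin.
rewrite IH addr0 RintegralZl//; last first.
  rewrite -restrict_EFin; apply/integrable_restrict => //; first exact: G_measurable.
  by apply: integrableS X_integrable => //; apply: measurableI => //; exact: G_measurable.
rewrite -Rintegral_mkcondr X_orth ?mulr0//.
Qed.

(** The simple approximations of [h] increase to it, so |X h| itself dominates their products with
    [X]. *)
Lemma orthogonal_ge0 (h : T -> R) A : (forall x, 0 <= h x) ->
  measurable_fun [set: g_sigma_algebraType G] h ->
  P.-integrable setT (EFin \o (X \* h)) ->
  G.-sigma.-measurable A -> \int[P]_(x in A) (X x * h x) = 0.
Proof.
move=> h0 mh iXh GA.
have mA := G_measurable A GA.
have mhE : measurable_fun [set: g_sigma_algebraType G] (EFin \o h).
  exact/measurable_EFinP.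
pose f := nnsfun_approx (@measurableT _ (g_sigma_algebraType G)) mhE.
have fh x : (f k x @[k --> \oo] --> h x).
  have hE : forall x, [set: g_sigma_algebraType G] x -> (0 <= (EFin \o h) x)%E.
    by move=> y _; rewrite lee_fin.
  exact: (fine_cvg (cvg_nnsfun_approx measurableT mhE hE (I : setT x))).
have f_le k x : f k x <= h x.
  rewrite -(cvg_lim _ (fh x))//; apply: nondecreasing_cvgn_le.
    by move=> m n mn; exact/lefP/nd_nnsfun_approx.
  by apply/cvg_ex; exists (h x).
have iXhA : P.-integrable A (EFin \o (X \* h)) by exact: integrableS iXh.
have mXf k : measurable_fun (A : set T) (fun x : T => X x * f k x).
  apply: measurable_funTS; apply: measurable_funM => //.
  by apply: (sub_sigma_measurable_fun (f k)); exact: (measurable_funP (f k)).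
have Xf_le k x : `|X x * f k x| <= `|X x * h x|.
  by rewrite !normrM ler_wpM2l// !ger0_norm.
have iXhN : P.-integrable A (EFin \o (fun x => `|X x * h x|)) := integrable_abse iXhA.
have cvgI : (\int[P]_(x in A) (X x * f k x)%:E)%E @[k --> \oo] -->
    (\int[P]_(x in A) (X x * h x)%:E)%E.
  apply: (@dominated_cvg _ _ _ P A mA _ _ (fun x => `|X x * h x|%:E)) => //.
  - by move=> k; apply/measurable_EFinP.
  - by move=> x _; apply: cvg_EFin; [exact: nearW|exact: cvgM (cvg_cst _) (fh x)].
  - by move=> k x _; rewrite /= lee_fin; exact: Xf_le.
have I0 : (\int[P]_(x in A) (X x * h x)%:E = 0)%E; last exact: (congr1 fine I0).
rewrite -(cvg_lim _ cvgI)//; apply: lim_near_cst => //; apply: nearW => k.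
rewrite -[LHS]fineK; last first.
  by apply: integrable_fin_num => //; exact: le_Rintegrable iXhN _.
by congr EFin; exact: orthogonal_nnsfun.
Qed.

Lemma orthogonal_measurable (h : T -> R) A :
  measurable_fun [set: g_sigma_algebraType G] h ->
  P.-integrable setT (EFin \o (X \* h)) ->
  G.-sigma.-measurable A -> \int[P]_(x in A) (X x * h x) = 0.
Proof.
move=> mh iXh GA.
have mA := G_measurable A GA.
pose hp x := Num.max (h x) 0; pose hn x := Num.max (- h x) 0.
have mhp : measurable_fun [set: g_sigma_algebraType G] hp by exact: measurable_maxr.
have mhn : measurable_fun [set: g_sigma_algebraType G] hn.
  by apply: measurable_maxr => //; exact: measurable_funN.
have hpn x : h x = hp x - hn x.
  by rewrite /hp /hn; have [|] := lerP (h x) 0; have [|] := lerP (- h x) 0; lra.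
have iXhN : P.-integrable setT (EFin \o (fun x => `|X x * h x|)) := integrable_abse iXh.
have int_part (g : T -> R) : measurable_fun [set: g_sigma_algebraType G] g ->
    (forall x, `|g x| <= `|h x|) -> P.-integrable setT (EFin \o (X \* g)).
  move=> mg gh; apply: le_Rintegrable iXhN _ => //.
    by apply: measurable_funM => //; exact: sub_sigma_measurable_fun.
  by move=> x _ /=; rewrite !normrM ler_wpM2l.
have ip : P.-integrable setT (EFin \o (X \* hp)).
  by apply: int_part => // x; rewrite /hp; have [|h0] := lerP (h x) 0; rewrite ?normr0.
have in_ : P.-integrable setT (EFin \o (X \* hn)).
  apply: int_part => // x; rewrite /hn.
  by have [|h0] := lerP (- h x) 0; rewrite ?normr0 ?normrN.
under eq_Rintegral do rewrite hpn mulrBr.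
rewrite RintegralB//; [|exact: integrableS ip|exact: integrableS in_].
by rewrite !orthogonal_ge0 ?subrr// => x; rewrite le_max lexx orbT.
Qed.
End OrthogonalToSubalgebra.

(** * Euclidean estimates *)

Section Euclidean.
Context {R : realType} {d : nat}.
Implicit Types u v w : 'rV[R]_d.

Lemma dotpC u v : dotp u v = dotp v u.
Proof. by apply: eq_bigr => i _; rewrite mulrC. Qed.

Lemma dotpDl u v w : dotp (u + v) w = dotp u w + dotp v w.
Proof. by rewrite -big_split; apply: eq_bigr => i _; rewrite mxE mulrDl. Qed.

Lemma dotpDr u v w : dotp w (u + v) = dotp w u + dotp w v.
Proof. by rewrite !(dotpC w) dotpDl. Qed.

Lemma dotpZl a u v : dotp (a *: u) v = a * dotp u v.
Proof. by rewrite mulr_sumr; apply: eq_bigr => i _; rewrite mxE mulrA. Qed.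

Lemma dotpZr a u v : dotp u (a *: v) = a * dotp u v.
Proof. by rewrite !(dotpC u) dotpZl. Qed.

Lemma dotpNl u v : dotp (- u) v = - dotp u v.
Proof. by rewrite -scaleN1r dotpZl mulN1r. Qed.

Lemma dotpNr u v : dotp u (- v) = - dotp u v.
Proof. by rewrite -scaleN1r dotpZr mulN1r. Qed.

Lemma dotp0l u : dotp 0 u = 0.
Proof. by rewrite -(scale0r u) dotpZl mul0r. Qed.

Lemma dotp_suml {I : Type} (r : seq I) (F : I -> 'rV[R]_d) u :
  dotp (\sum_(i <- r) F i) u = \sum_(i <- r) dotp (F i) u.
Proof.
elim: r => [|i r IH]; first by rewrite !big_nil dotp0l.
by rewrite !big_cons dotpDl IH.
Qed.

Lemma dotp_sumr {I : Type} (r : seq I) (F : I -> 'rV[R]_d) u :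
  dotp u (\sum_(i <- r) F i) = \sum_(i <- r) dotp u (F i).
Proof. by rewrite dotpC dotp_suml; apply: eq_bigr => i _; rewrite dotpC. Qed.

Definition dotpE := (dotpDl, dotpDr, dotpZl, dotpZr, dotpNl, dotpNr).

Lemma dotp_ge0 u : 0 <= dotp u u.
Proof. by apply: sumr_ge0 => i _; rewrite -expr2 sqr_ge0. Qed.

Lemma sqr_enorm u : enorm u ^+ 2 = dotp u u.
Proof. by rewrite sqr_sqrtr// dotp_ge0. Qed.

Lemma sqr_coord_le u i : u ord0 i ^+ 2 <= dotp u u.
Proof.
rewrite /dotp (bigD1 i)//= -expr2 lerDl; apply: sumr_ge0 => j _.
by rewrite -expr2 sqr_ge0.
Qed.

Lemma dotpDD_le u v : dotp (u + v) (u + v) <= 2 * dotp u u + 2 * dotp v v.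
Proof. have := dotp_ge0 (u - v); rewrite !dotpE (dotpC v u); lra. Qed.

Lemma enorm_ge0 u : 0 <= enorm u. Proof. exact: sqrtr_ge0. Qed.

Lemma enorm_le_norm1 u : enorm u <= \sum_j `|u ord0 j|.
Proof.
have S0 : 0 <= \sum_j `|u ord0 j| by exact: sumr_ge0.
rewrite -(ler_sqr (enorm_ge0 u) S0) ?nnegrE ?enorm_ge0// sqr_enorm expr2 mulr_suml.
apply: ler_sum => i _; apply: le_trans (ler_norm _) _; rewrite normrM ler_wpM2l//.
by rewrite (bigD1 i)//= lerDl sumr_ge0.
Qed.

Lemma coord_le_enorm u i : `|u ord0 i| <= enorm u.
Proof.
rewrite -(@ler_pXn2r _ 2)// ?nnegrE ?enorm_ge0// sqr_enorm.
by rewrite real_normK ?num_real// sqr_coord_le.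
Qed.

Lemma lipschitz_sqr (L : R) (B : 'rV[R]_d -> 'rV[R]_d) u v : lipschitz_with L B ->
  dotp (B u - B v) (B u - B v) <= L ^+ 2 * dotp (u - v) (u - v).
Proof.
move=> /(_ u v) h; rewrite -!sqr_enorm -exprMn.
by rewrite ler_pXn2r// ?nnegrE ?enorm_ge0//; apply: le_trans h; exact: enorm_ge0.
Qed.

(** Cauchy-Schwarz in the form 0 <= |L c - b|^2, combined with |b|^2 <= L^2 |c|^2. *)
Lemma lipschitz_dotp_le (L : R) (B : 'rV[R]_d -> 'rV[R]_d) u v : 0 < L ->
  lipschitz_with L B -> dotp (u - v) (B u - B v) <= L * dotp (u - v) (u - v).
Proof.
move=> L0 /lipschitz_sqr - /(_ u v).
move: (B u - B v) (u - v) => b c bc.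
have := dotp_ge0 (L *: c - b); rewrite !dotpE (dotpC b c) => h.
have : L * dotp c b <= L * (L * dotp c c) by nra.
by rewrite ler_pM2l.
Qed.

(** On expanding the square, the cross term is nonnegative by monotonicity. This makes the resolvent
    nonexpansive, whence both the measurability and the growth of [x]. *)
Lemma resolvent_contraction (A : 'rV[R]_d -> set 'rV[R]_d) tau x a x' a' :
  0 < tau -> monotone_op A -> A x a -> A x' a' ->
  dotp (x - x') (x - x') + tau ^+ 2 * dotp (a - a') (a - a') <=
  dotp (x + tau *: a - (x' + tau *: a')) (x + tau *: a - (x' + tau *: a')).
Proof.
move=> tau0 mA Axa Axa'; have := mA _ _ _ _ Axa Axa'.
have -> : x + tau *: a - (x' + tau *: a') = (x - x') + tau *: (a - a').
  by rewrite scalerBr opprD addrACA.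
move: (x - x') (a - a') => p q pq.
rewrite (dotpDl p) !(dotpDr p) !dotpZl !dotpZr (dotpC p q); nra.
Qed.

(** A calculus of quadratic growth: it is stable under sums, bounded scalings and Lipschitz maps, so
    the existence of a bound follows the formulas of the algorithm without tracking constants. [C]
    is uniform in [s]. *)
Definition sqr_dominated {S : Type} (M : S -> R) (u : S -> 'rV[R]_d) :=
  exists2 C, 0 <= C & forall s, dotp (u s) (u s) <= C * M s.

Section Domination.
Context {S : Type}.
Implicit Types (M N : S -> R) (f g : S -> 'rV[R]_d).

Lemma sqr_dominatedD M f g : sqr_dominated M f -> sqr_dominated M g ->
  sqr_dominated M (fun s => f s + g s).
Proof.
move=> [C C0 hC] [D D0 hD]; exists (2 * C + 2 * D); first by rewrite addr_ge0 ?mulr_ge0.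
move=> s; apply: le_trans (dotpDD_le _ _) _.
have := hC s; have := hD s; lra.
Qed.

Lemma sqr_dominatedZ M (c : S -> R) K f : (forall s, 0 <= M s) ->
  (forall s, `|c s| <= K) -> sqr_dominated M f ->
  sqr_dominated M (fun s => c s *: f s).
Proof.
move=> M0 cK [C C0 hC]; exists (K ^+ 2 * C); first by rewrite mulr_ge0// sqr_ge0.
move=> s; rewrite dotpZl dotpZr mulrA -expr2 -mulrA.
have cK2 : c s ^+ 2 <= K ^+ 2.
  rewrite -(real_normK (num_real (c s))) ler_pXn2r// ?nnegrE//.
  by apply: le_trans (cK s).
by apply: ler_pM => //; rewrite ?sqr_ge0 ?dotp_ge0.
Qed.

Lemma sqr_dominatedN M f : sqr_dominated M f -> sqr_dominated M (fun s => - f s).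
Proof. by move=> [C C0 hC]; exists C => // s; rewrite dotpNl dotpNr opprK. Qed.

Lemma sqr_dominatedB M f g : sqr_dominated M f -> sqr_dominated M g ->
  sqr_dominated M (fun s => f s - g s).
Proof. by move=> hf hg; apply: sqr_dominatedD => //; exact: sqr_dominatedN. Qed.

Lemma sqr_dominated_sum {I : Type} (r : seq I) M (F : I -> S -> 'rV[R]_d) :
  (forall i, sqr_dominated M (F i)) ->
  sqr_dominated M (fun s => \sum_(i <- r) F i s).
Proof.
move=> hF; elim: r => [|i r [C C0 hC]].
  by exists 0 => // s; rewrite big_nil dotp0l mul0r.
have [D D0 hD] : sqr_dominated M (fun s => F i s + \sum_(j <- r) F j s).
  by apply: sqr_dominatedD => //; exists C.
by exists D => // s; rewrite big_cons.
Qed.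

Lemma sqr_dominated_cst M u : (forall s, 1 <= M s) -> sqr_dominated M (fun=> u).
Proof.
move=> M1; exists (dotp u u); first exact: dotp_ge0.
by move=> s; rewrite ler_peMr ?dotp_ge0.
Qed.

Lemma sqr_dominated_le M N f : (forall s, M s <= N s) ->
  sqr_dominated M f -> sqr_dominated N f.
Proof.
move=> MN [C C0 hC]; exists C => // s; apply: le_trans (hC s) _.
by rewrite ler_wpM2l.
Qed.

Lemma sqr_dominated_dist M f u : (forall s, 1 <= M s) ->
  sqr_dominated M (fun s => f s - u) -> sqr_dominated M f.
Proof.
move=> M1 hf.
have [C C0 hC] : sqr_dominated M (fun s => (f s - u) + u).
  by apply: sqr_dominatedD => //; exact: sqr_dominated_cst.
by exists C => // s; have := hC s; rewrite subrK.
Qed.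

Lemma sqr_dominated_lipschitz M L B f : (forall s, 1 <= M s) ->
  lipschitz_with L B -> sqr_dominated M f -> sqr_dominated M (fun s => B (f s)).
Proof.
move=> M1 lipB hf; apply: (@sqr_dominated_dist _ _ (B 0)) => //.
have [C C0 hC] := hf.
exists (L ^+ 2 * C); first by rewrite mulr_ge0// sqr_ge0.
move=> s; apply: le_trans (lipschitz_sqr L B (f s) 0 lipB) _.
by rewrite subr0 -[leRHS]mulrA ler_wpM2l ?sqr_ge0.
Qed.
End Domination.

(* [y_i] and [B xB + e] being (approximate) operator values at [x_i] and [xB],
   the sum of [<z - x_i, y_i - w_i>] is affine in [(z, w)]; its increment between
   [(z, w)] and the solution is the left-hand side, where only the noise [e]
   against [z - zs] survives. *)
Lemma separation_bound {n : nat} (A : 'I_n -> 'rV[R]_d -> set 'rV[R]_d)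
    (B : 'rV[R]_d -> 'rV[R]_d) (L tau rho : R)
    (z wB eps e xB xbar zs : 'rV[R]_d) (w x y ws : 'I_n -> 'rV[R]_d) :
  (forall i, monotone_op (A i)) -> monotone_fun B -> 0 < L -> lipschitz_with L B ->
  0 < tau -> (forall i, A i (x i) (y i)) ->
  (forall i, z + tau *: w i = x i + tau *: y i) -> \sum_(i < n) w i + wB = 0 ->
  (forall i, A i zs (ws i)) -> \sum_(i < n) ws i + B zs = 0 ->
  xB = z - rho *: (B z + eps - wB) ->
  tau^-1 * (\sum_(i < n) dotp (z - x i) (z - x i))
    + rho * (1 - rho * L) * dotp (B z - wB) (B z - wB)
    + (rho - 2 * L * rho ^+ 2) * dotp eps (B z - wB)
    - L * rho ^+ 2 * dotp eps eps + dotp e (z - zs) <=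
  dotp (\sum_(i < n) y i + (B xB + e)) (z - zs)
    + \sum_(i < n) dotp (x i - xbar) (w i - ws i) + dotp (xB - xbar) (wB - B zs).
Proof.
move=> mA mB L0 lipB tau0 Axy zw Sw Asw Ssw xBE.
(* Here [a], [b], [c], [f] stand for x_i, y_i, w_i and the solution's w_i. The last bracket is
   linear in [(c, f)] and free of [a] and [b], so it disappears on summing the n+1 blocks, where
   both dual families add up to zero. *)
have termE (a b c f : 'rV[R]_d) :
   dotp (z - a) (b - c) - dotp (zs - a) (b - f) =
   dotp b (z - zs) + dotp (a - xbar) (c - f)
   + (dotp xbar c - dotp xbar f - dotp z c + dotp zs f).
  rewrite !dotpE (dotpC b z) (dotpC b zs); ring.
have sumE u : \sum_(i < n) dotp u (w i) = - dotp u wB.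
  by apply/eqP; rewrite -dotp_sumr -addr_eq0 -dotpDr Sw dotpC dotp0l.
have sumsE u : \sum_(i < n) dotp u (ws i) = - dotp u (B zs).
  by apply/eqP; rewrite -dotp_sumr -addr_eq0 -dotpDr Ssw dotpC dotp0l.
have -> : dotp (\sum_(i < n) y i + (B xB + e)) (z - zs)
    + \sum_(i < n) dotp (x i - xbar) (w i - ws i) + dotp (xB - xbar) (wB - B zs) =
    \sum_(i < n) (dotp (z - x i) (y i - w i) - dotp (zs - x i) (y i - ws i))
    + (dotp (z - xB) (B xB + e - wB) - dotp (zs - xB) (B xB + e - B zs)).
  rewrite [in RHS]termE; under [in RHS]eq_bigr do rewrite termE.
  rewrite !big_split/= !sumrN !sumE !sumsE.
  by rewrite (dotpDl (\sum_(i < n) y i)) dotp_suml; ring.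
(* The resolvent identity gives y_i - w_i = (z - x_i) / tau, hence the square; the other product is
   nonnegative by monotonicity. *)
have op_term i : tau^-1 * dotp (z - x i) (z - x i) <=
    dotp (z - x i) (y i - w i) - dotp (zs - x i) (y i - ws i).
  have := mA i _ _ _ _ (Axy i) (Asw i).
  have -> : dotp (zs - x i) (y i - ws i) = - dotp (y i - ws i) (x i - zs).
    by rewrite dotpC -dotpNr opprB.
  have -> : y i - w i = tau^-1 *: (z - x i).
    have -> : z - x i = tau *: (y i - w i).
      by rewrite -[z](addrK (tau *: w i)) zw scalerBr [x i + _]addrC addrAC addrK.
    by rewrite scalerA mulVf ?scale1r// gt_eqF.
  by rewrite dotpZr; lra.
(* The products of [e] with [z - xB] cancel. Monotonicity of [B] disposes of [xB] against [zs], and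
   its Lipschitz bound costs L |z - xB|^2 = L rho^2 |B z - wB + eps|^2, whose expansion gives the
   coefficients. *)
have B_term : rho * (1 - rho * L) * dotp (B z - wB) (B z - wB)
    + (rho - 2 * L * rho ^+ 2) * dotp eps (B z - wB)
    - L * rho ^+ 2 * dotp eps eps + dotp e (z - zs) <=
    dotp (z - xB) (B xB + e - wB) - dotp (zs - xB) (B xB + e - B zs).
  have := mB xB zs; have := lipschitz_dotp_le L B z xB L0 lipB.
  have zxB : z - xB = rho *: (B z - wB + eps).
    by rewrite xBE opprB addrC subrK addrAC.
  have -> : zs - xB = (z - xB) - (z - zs) by rewrite opprB [RHS]addrC addrA subrK.
  have -> : xB - zs = (z - zs) - (z - xB) by rewrite opprB [RHS]addrC addrA subrK.
  have -> : B xB + e - wB = (B z - wB) - (B z - B xB) + e.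
    by rewrite opprB [B z - wB + _]addrC addrA subrK addrAC.
  have -> : B xB + e - B zs = (B xB - B zs) + e by rewrite addrAC.
  rewrite zxB.
  move: (B z - wB) (B z - B xB) (B xB - B zs) (z - zs) => p q r c.
  rewrite !dotpE (dotpC p eps) (dotpC c e) (dotpC c r) (dotpC r p) (dotpC r eps).
  lra.
apply: le_trans (lerD (ler_sum _ (fun i _ => op_term i)) B_term).
rewrite mulr_sumr; lra.
Qed.
End Euclidean.

(** * Pathwise convergence *)

(** A cluster point exists by compactness, and an ultrafilter converges to each of its cluster
    points. This replaces the successive extraction of subsequences for the coordinates. *)
Lemma ultrafilter_bounded_cvg {R : realType} {I : Type} (G : set_system I)
    (u : I -> R) (M : R) :
  UltraFilter G -> (\forall k \near G, `|u k| <= M) -> cvg (u @ G).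
Proof.
move=> GU uM.
have [l [_ cl]] : `[- M, M] `&` cluster (u @ G) !=set0.
  apply: segment_compact; apply: filterS uM => k /=.
  by rewrite in_itv/= ler_norml.
apply/cvg_ex; exists l => A lA.
have [//|nA] := in_ultra_setVsetC (u @^-1` A) GU.
by have [x [nAx Ax]] := cl (~` A) A nA lA.
Qed.

Lemma cvg_sum_seq {R : realType} {I : Type} {G : set_system I} {FG : Filter G}
    {J : Type} (r : seq J) (u : J -> I -> R) (l : J -> R) :
  (forall j, u j k @[k --> G] --> l j) ->
  (\sum_(j <- r) u j k) @[k --> G] --> \sum_(j <- r) l j.
Proof.
move=> ul; elim: r => [|j r IH].
  by rewrite big_nil; under eq_fun do rewrite big_nil; exact: cvg_cst.
by rewrite big_cons; under eq_fun do rewrite big_cons; exact: cvgD.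
Qed.

Section CoordinatewiseLimits.
Context {R : realType} {d : nat} {I : Type} (G : set_system I) {PG : ProperFilter G}.
Implicit Types (u v : I -> 'rV[R]_d) (l m : 'rV[R]_d).

Definition coord_cvg u l := forall c, u k ord0 c @[k --> G] --> l ord0 c.

Lemma coord_cvgD u v l m :
  coord_cvg u l -> coord_cvg v m -> coord_cvg (fun k => u k + v k) (l + m).
Proof.
by move=> ul vm c; rewrite mxE; under eq_fun do rewrite mxE; exact: cvgD (ul c) (vm c).
Qed.

Lemma coord_cvgZ a u l : coord_cvg u l -> coord_cvg (fun k => a *: u k) (a *: l).
Proof.
move=> ul c; rewrite mxE; under eq_fun do rewrite mxE.
exact: cvgM (cvg_cst a) (ul c).
Qed.

Lemma coord_cvgN u l : coord_cvg u l -> coord_cvg (fun k => - u k) (- l).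
Proof.
by move=> ul c; rewrite mxE; under eq_fun do rewrite mxE; exact: cvgN (ul c).
Qed.

Lemma coord_cvg_cst l : coord_cvg (fun=> l) l.
Proof. by move=> c; exact: cvg_cst. Qed.

Lemma coord_cvgB u v l m :
  coord_cvg u l -> coord_cvg v m -> coord_cvg (fun k => u k - v k) (l - m).
Proof. by move=> ul vm; apply: coord_cvgD => //; exact: coord_cvgN. Qed.

Lemma coord_cvg_unique u l m : coord_cvg u l -> coord_cvg u m -> l = m.
Proof.
move=> ul um; apply/rowP => c.
exact: (@cvg_unique _ (@Rhausdorff R) _ _ _ _ (ul c) (um c)).
Qed.

Lemma coord_cvg_sum {J : Type} (r : seq J) (u : J -> I -> 'rV[R]_d)
    (l : J -> 'rV[R]_d) :
  (forall j, coord_cvg (u j) (l j)) ->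
  coord_cvg (fun k => \sum_(j <- r) u j k) (\sum_(j <- r) l j).
Proof.
move=> ul c; rewrite summxE; under eq_fun do rewrite summxE.
by apply: cvg_sum_seq => j; exact: ul.
Qed.

Lemma cvg_dotp u v l m : coord_cvg u l -> coord_cvg v m ->
  dotp (u k) (v k) @[k --> G] --> dotp l m.
Proof. by move=> ul vm; apply: cvg_sum_seq => c; exact: cvgM (ul c) (vm c). Qed.

Lemma coord_cvg_dist u v l : coord_cvg v l ->
  dotp (u k - v k) (u k - v k) @[k --> G] --> (0 : R) -> coord_cvg u l.
Proof.
move=> vl uv c; apply/cvgrPdist_lt => e e0.
have e2 : 0 < e / 2 by rewrite divr_gt0.
have /cvgrPdist_lt/(_ _ e2) h1 := vl c.
have /cvgrPdist_lt/(_ _ (exprn_gt0 2 e2)) h2 := uv.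
near=> k.
have d1 : `|l ord0 c - v k ord0 c| < e / 2 by near: k.
have : `|0 - dotp (u k - v k) (u k - v k)| < (e / 2) ^+ 2 by near: k.
rewrite sub0r normrN ger0_norm ?dotp_ge0// => d2.
have : `|(u k - v k) ord0 c| < e / 2.
  rewrite -(@ltr_pXn2r _ 2)// ?nnegrE ?ltW// real_normK ?num_real//.
  exact: le_lt_trans (sqr_coord_le _ _) d2.
rewrite !mxE => d3.
have -> : l ord0 c - u k ord0 c = (l ord0 c - v k ord0 c) - (u k ord0 c - v k ord0 c).
  by ring.
by apply: le_lt_trans (ler_normB _ _) _; lra.
Unshelve. all: by end_near. Qed.

Lemma coord_cvg_lipschitz L B u l : lipschitz_with L B -> coord_cvg u l ->
  coord_cvg (fun k => B (u k)) (B l).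
Proof.
move=> lipB ul; apply: coord_cvg_dist (coord_cvg_cst _) _.
have ub : L ^+ 2 * dotp (u k - l) (u k - l) @[k --> G] --> (0 : R).
  rewrite -(mulr0 (L ^+ 2)); apply: cvgM; first exact: cvg_cst.
  have -> : 0 = dotp (l - l) (l - l) by rewrite subrr dotp0l.
  by apply: cvg_dotp; apply: coord_cvgB => //; exact: coord_cvg_cst.
apply: (@squeeze_cvgr _ _ _ _ (cst 0) _ _ _ _ _ ub); last exact: cvg_cst.
by apply: nearW => k; rewrite dotp_ge0 (lipschitz_sqr _ _ _ _ lipB).
Qed.

(** Monotonicity inequalities pass to the limit, so adding the point [(l, m)] to the graph keeps it
    monotone; maximality says that it was already there. *)
Lemma maximal_monotone_closed (A : 'rV[R]_d -> set 'rV[R]_d) u v l m :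
  maximal_monotone A -> (forall k, A (u k) (v k)) ->
  coord_cvg u l -> coord_cvg v m -> A l m.
Proof.
move=> [mA maxA] Auv ul vm.
pose A' x := A x `|` [set y | x = l /\ y = m].
have lim_ge0 x a : A x a -> 0 <= dotp (m - a) (l - x).
  move=> Axa; have cv : dotp (v k - a) (u k - x) @[k --> G] --> dotp (m - a) (l - x).
    by apply: cvg_dotp; apply: coord_cvgB => //; exact: coord_cvg_cst.
  rewrite -(cvg_lim (@Rhausdorff R) cv); apply: limr_ge.
    by apply/cvg_ex; exists (dotp (m - a) (l - x)).
  by apply: nearW => k; exact: mA.
suff <- : A' = A by right.
apply: maxA => [x y a b|x y]; last by left.
move=> [Axa|[-> ->]] [Ayb|[-> ->]].
- exact: mA.
- by rewrite -(opprB m) -(opprB l) dotpNl dotpNr opprK; exact: lim_ge0.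
- exact: lim_ge0.
- by rewrite subrr dotp0l.
Qed.
End CoordinatewiseLimits.

(** * Extended solutions and the limit of a single path *)

Section ExtendedSolutions.
Context {R : realType} {d n : nat}.
Variables (A : 'I_n -> 'rV[R]_d -> set 'rV[R]_d) (B : 'rV[R]_d -> 'rV[R]_d).
Implicit Types (p : 'rV[R]_d * ('I_n -> 'rV[R]_d)).

(* The dual component of the single-valued operator is determined: it is [B z]. *)
Definition extended_solution p :=
  (forall i, A i p.1 (p.2 i)) /\ \sum_(i < n) p.2 i + B p.1 = 0.

Definition sqr_dist p (z : 'rV[R]_d) (w : 'I_n -> 'rV[R]_d) (wB : 'rV[R]_d) :=
  dotp (z - p.1) (z - p.1) + \sum_(i < n) dotp (w i - p.2 i) (w i - p.2 i)
  + dotp (wB - B p.1) (wB - B p.1).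

Lemma sum_dotp_ge0 (w : 'I_n -> 'rV[R]_d) : 0 <= \sum_(i < n) dotp (w i) (w i).
Proof. by apply: sumr_ge0 => i _; exact: dotp_ge0. Qed.

Lemma sqr_dist_ge p z w wB :
  [/\ dotp (z - p.1) (z - p.1) <= sqr_dist p z w wB,
      forall i, dotp (w i - p.2 i) (w i - p.2 i) <= sqr_dist p z w wB,
      dotp (wB - B p.1) (wB - B p.1) <= sqr_dist p z w wB &
      0 <= sqr_dist p z w wB].
Proof.
have h1 := dotp_ge0 (z - p.1); have h3 := dotp_ge0 (wB - B p.1).
have h2 := sum_dotp_ge0 (fun i => w i - p.2 i).
rewrite /sqr_dist; split=> [|i||]; try lra.
rewrite (bigD1 i)//= in h2 *.
have : 0 <= \sum_(j < n | j != i) dotp (w j - p.2 j) (w j - p.2 j).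
  by apply: sumr_ge0 => j _; exact: dotp_ge0.
by lra.
Qed.

Lemma dense_solutions p0 : extended_solution p0 ->
  exists s : nat -> 'rV[R]_d * ('I_n -> 'rV[R]_d),
    (forall k, extended_solution (s k)) /\
    forall p, extended_solution p -> forall e, 0 < e -> exists k,
      (forall c, `|(p.1 - (s k).1) ord0 c| < e) /\
      (forall i c, `|(p.2 i - (s k).2 i) ord0 c| < e).
Proof.
move=> hp0.
(* [None] selects the primal coordinates and [Some i] those of the i-th dual vector; the block
   [B p.1] is controlled by the first through the Lipschitz bound. *)
pose X (p : {p | extended_solution p}) (j : option 'I_n * 'I_d) : R :=
  if j.1 is Some i then (sval p).2 i ord0 j.2 else (sval p).1 ord0 j.2.
have [s hs] := dense_sequence X (exist _ p0 hp0).
exists (fun k => sval (s k)); split=> [k|p hp e e0]; first exact: (svalP (s k)).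
have [k hk] := hs (exist _ p hp) e e0; exists k; split=> [c|i c].
  by have := hk (None, c); rewrite /X /= !mxE.
by have := hk (Some i, c); rewrite /X /= !mxE.
Qed.

Lemma dotp_le_coord (u : 'rV[R]_d) e : (forall c, `|u ord0 c| < e) ->
  dotp u u <= d%:R * e ^+ 2.
Proof.
move=> ue; rewrite mulr_natl -[X in _ *+ X](card_ord d) -sumr_const.
apply: ler_sum => c _; rewrite -expr2 -(real_normK (num_real _)).
by rewrite ler_pXn2r// ?nnegrE ?ltW//; exact: le_lt_trans (ue c).
Qed.

Variables (L tau : R).
Hypothesis (A_max : forall i, maximal_monotone (A i))
  (B_lip : lipschitz_with L B) (tau_gt0 : 0 < tau).
Variables (s : nat -> 'rV[R]_d * ('I_n -> 'rV[R]_d)).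
Hypothesis s_dense : forall p, extended_solution p -> forall e, 0 < e ->
  exists k, (forall c, `|(p.1 - (s k).1) ord0 c| < e) /\
            (forall i c, `|(p.2 i - (s k).2 i) ord0 c| < e).
Variables (z wB : nat -> 'rV[R]_d) (w x : nat -> 'I_n -> 'rV[R]_d).
Hypothesis x_resolvent : forall k i,
  resolvent_rel tau (A i) (z k + tau *: w k i) (x k i).
Hypothesis w_sum : forall k, \sum_(i < n) w k i + wB k = 0.
Hypothesis dist_cvg : forall m, cvgn (fun k => sqr_dist (s m) (z k) (w k) (wB k)).
Hypothesis residual_small : forall e N, 0 < e -> exists2 k, (N <= k)%N &
  \sum_(i < n) dotp (z k - x k i) (z k - x k i)
  + dotp (B (z k) - wB k) (B (z k) - wB k) < e.

Let residual k := \sum_(i < n) dotp (z k - x k i) (z k - x k i)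
  + dotp (B (z k) - wB k) (B (z k) - wB k).

(* Along an ultrafilter on which the residual vanishes, the bounded iterates
   converge to an extended solution. *)
Lemma cluster_solution :
  exists (G : set_system nat) (p : 'rV[R]_d * ('I_n -> 'rV[R]_d)),
  [/\ UltraFilter G, \oo `<=` G, extended_solution p, coord_cvg G z p.1 &
      (forall i, coord_cvg G (fun k => w k i) (p.2 i)) /\ coord_cvg G wB (B p.1)].
Proof.
pose small N e := [set k | (N <= k)%N /\ residual k < e].
(* Its generators are the tails restricted to times of small residual; they are nonempty by
   [residual_small], so the filter is proper and refines [\oo]. *)
pose F0 : set_system nat := [set S | exists N e, 0 < e /\ small N e `<=` S].
have F0_filter : ProperFilter F0.
  split.
    move=> [N [e [e0]]]; have [k Nk rk] := residual_small e N e0.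
    by move=> /(_ k); apply; split.
  split.
  - by exists 0%N, 1; split.
  - move=> S S' [N [e [e0 hS]]] [N' [e' [e'0 hS']]].
    exists (maxn N N'), (Num.min e e'); split; first by rewrite lt_min e0.
    move=> k [/=]; rewrite geq_max lt_min => /andP[k1 k2] /andP[r1 r2].
    by split; [apply: hS|apply: hS'].
  - move=> S S' SS' [N [e [e0 hS]]]; exists N, e; split=> //.
    exact: subset_trans SS'.
have [G [GU FG]] := @ultraFilterLemma _ F0 F0_filter.
have ooG : \oo `<=` G.
  move=> S [N _ hN]; apply: FG; exists N, 1; split=> // k [Nk _]; exact: hN.
have res0 : residual k @[k --> G] --> (0 : R).
  apply/cvgrPdist_lt => e e0; apply: FG; exists 0%N, e; split=> // k [_ /= rk].
  rewrite sub0r normrN ger0_norm// /residual addr_ge0 ?dotp_ge0//.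
  exact: (sum_dotp_ge0 (fun i => z k - x k i)).
have [M hM] : exists M, \forall k \near G, sqr_dist (s 0%N) (z k) (w k) (wB k) <= M.
  have /cvg_ex[l /cvgrPdist_lt/(_ 1 ltr01) hl] := dist_cvg 0%N.
  exists (l + 1); apply: ooG; apply: filterS hl => k /=.
  by rewrite ltr_distlC => /andP[_ /ltW].
have lim_of (u : nat -> 'rV[R]_d) (a : 'rV[R]_d) :
    (forall k, dotp (u k - a) (u k - a) <= sqr_dist (s 0%N) (z k) (w k) (wB k)) ->
    exists l, coord_cvg G u l.
  move=> ua.
  have /choice[l hl] : forall c, exists l : R, u k ord0 c @[k --> G] --> l.
    (* The radius uses t <= 1 + t^2 to bound a coordinate by a squared distance without a square
       root. *)
    move=> c; apply/cvg_ex; apply: (@ultrafilter_bounded_cvg _ _ _ _ (1 + M + `|a ord0 c|)).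
    apply: filterS hM => k hk.
    have := sqr_coord_le (u k - a) c; have := ua k; rewrite !mxE.
    have : `|u k ord0 c| <= `|u k ord0 c - a ord0 c| + `|a ord0 c|.
      by rewrite -[X in `|X| <= _](subrK (a ord0 c)) ler_normD.
    rewrite -(real_normK (num_real (u k ord0 c - a ord0 c))).
    have := normr_ge0 (u k ord0 c - a ord0 c); nra.
  by exists (\row_c l c) => c; rewrite mxE.
have [z' hz] : exists l, coord_cvg G z l.
  by apply: (lim_of z (s 0%N).1) => k; case: (sqr_dist_ge (s 0%N) (z k) (w k) (wB k)).
have /choice[w' hw] : forall i, exists l, coord_cvg G (fun k => w k i) l.
  move=> i.
  apply: (lim_of (fun k => w k i) ((s 0%N).2 i)) => k.
  by case: (sqr_dist_ge (s 0%N) (z k) (w k) (wB k)).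
have part0 (f : nat -> R) : (forall k, 0 <= f k <= residual k) ->
    f k @[k --> G] --> (0 : R).
  move=> hf; apply: (@squeeze_cvgr _ _ _ _ (cst 0) _ _ _ _ _ res0); last exact: cvg_cst.
  exact: nearW.
have hx i : coord_cvg G (fun k => x k i) z'.
  apply: coord_cvg_dist hz _; apply: part0 => k.
  rewrite dotp_ge0 -opprB dotpNl dotpNr opprK /residual (bigD1 i)//= -addrA lerDl.
  by rewrite addr_ge0 ?dotp_ge0// sumr_ge0// => j _; exact: dotp_ge0.
have hBz : coord_cvg G (fun k => B (z k)) (B z') by exact: coord_cvg_lipschitz B_lip hz.
have hwB : coord_cvg G wB (B z').
  apply: coord_cvg_dist hBz _; apply: part0 => k.
  rewrite dotp_ge0 -opprB dotpNl dotpNr opprK /residual lerDr.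
  exact: (sum_dotp_ge0 (fun i => z k - x k i)).
(* This vector is the element of [A i (x k i)] given by the resolvent; it has the limit of [w k i]
   because z - x_i tends to 0. *)
have hy i : coord_cvg G (fun k => tau^-1 *: (z k - x k i) + w k i) (w' i).
  rewrite -[w' i]add0r -(scaler0 _ tau^-1) -(subrr z').
  by apply: coord_cvgD (hw i); apply: coord_cvgZ; exact: coord_cvgB.
exists G, (z', w'); split=> //; split=> /= [i|].
  apply: maximal_monotone_closed (A_max i) _ (hx i) (hy i) => k.
  have [a [Aa ta]] := x_resolvent k i.
  suff -> : tau^-1 *: (z k - x k i) + w k i = a by [].
  have : tau *: a = z k - x k i + tau *: w k i.
    by rewrite addrAC ta addrAC subrr add0r.
  move=> /(congr1 (fun u => tau^-1 *: u)).
  by rewrite scalerDr !scalerA mulVf ?gt_eqF// !scale1r.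
apply: (coord_cvg_unique G (fun k => \sum_(i < n) w k i + wB k)).
  by apply: coord_cvgD hwB; exact: coord_cvg_sum.
by under eq_fun do rewrite w_sum; exact: coord_cvg_cst.
Qed.

(** The distance to the cluster point itself is not known to converge, but that to a nearby [s m]
    is. Its limit is computed along [G], hence is small, so [z k] is eventually close to [s m] and
    thus to [z']. *)
Lemma iterates_cvg : exists zs, cvg_vec z zs /\ is_zero_of_sum A B zs.
Proof.
have [G [[z' w'] /= [GU ooG sol hz [hw hwB]]]] := cluster_solution.
exists z'; split; last by exists w'; exact: sol.
suff cz c : z k ord0 c @[k --> \oo] --> z' ord0 c.
  apply/cvg_ballP => e e0.
  have : \forall k \near \oo, forall c, `|z' ord0 c - z k ord0 c| < e.
    by apply: filter_forall => c; have /cvgrPdist_lt/(_ e e0) := cz c.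
  by apply: filterS => k hk; split=> // i j; rewrite (ord1 i); exact: hk.
apply/cvgrPdist_lt => e e0.
(* With coordinates within [dl], each vector contributes at most d dl^2: one for [z], n for the [w],
   and L^2 for the block of [B]. Then [dl * (C + 1) = f] makes C dl^2 < f^2. *)
pose C := d%:R * (1 + n%:R + L ^+ 2).
have C0 : 0 <= C by rewrite mulr_ge0// !addr_ge0// sqr_ge0.
pose f := e / 2; have f0 : 0 < f by rewrite divr_gt0.
pose dl := f / (C + 1).
have dl0 : 0 < dl by rewrite divr_gt0// ltr_wpDl.
have dlE : dl * (C + 1) = f by rewrite /dl divfK// gt_eqF// ltr_wpDl.
have [m [mz mw]] := s_dense _ sol dl dl0.
pose V k := sqr_dist (s m) (z k) (w k) (wB k).
pose V' := sqr_dist (s m) z' w' (B z').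
have VV' : V k @[k --> \oo] --> V'.
  have GV : V k @[k --> G] --> V'.
    apply: cvgD; last by apply: cvg_dotp; apply: coord_cvgB => //; exact: coord_cvg_cst.
    apply: cvgD; first by apply: cvg_dotp; apply: coord_cvgB => //; exact: coord_cvg_cst.
    apply: cvg_sum_seq => i.
    by apply: cvg_dotp; apply: coord_cvgB => //; exact: coord_cvg_cst.
  have /cvg_ex[l Vl] := dist_cvg m.
  suff -> : V' = l by [].
  apply: (@cvg_unique _ (@Rhausdorff R) _ _ _ _ GV) => S lS.
  by apply: ooG; exact: Vl.
have V'_lt : V' < f ^+ 2.
  have dz := dotp_le_coord _ _ mz.
  have dB := lipschitz_sqr L B z' (s m).1 B_lip.
  have dw : \sum_(i < n) dotp (w' i - (s m).2 i) (w' i - (s m).2 i) <=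
      n%:R * (d%:R * dl ^+ 2).
    rewrite mulr_natl -[X in _ *+ X](card_ord n) -sumr_const.
    by apply: ler_sum => i _; exact: dotp_le_coord.
  have dB' : L ^+ 2 * dotp (z' - (s m).1) (z' - (s m).1) <= L ^+ 2 * (d%:R * dl ^+ 2).
    by rewrite ler_wpM2l ?sqr_ge0.
  apply: (@le_lt_trans _ _ (C * dl ^+ 2)); last by rewrite -dlE; nra.
  rewrite /V' /sqr_dist /=; apply: le_trans (lerD (lerD dz dw) (le_trans dB dB')) _.
  rewrite /C; lra.
have /cvgrPdist_lt/(_ (f ^+ 2 - V')) := VV'.
rewrite subr_gt0 => /(_ V'_lt); apply: filterS => k.
rewrite ltr_distlC => /andP[_ Vk].
have {}Vk : V k < f ^+ 2 by lra.
have zk : `|(z k - (s m).1) ord0 c| < f.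
  rewrite -(@ltr_pXn2r _ 2)// ?nnegrE ?ltW// real_normK ?num_real//.
  apply: le_lt_trans (sqr_coord_le _ _) _; apply: le_lt_trans Vk.
  by case: (sqr_dist_ge (s m) (z k) (w k) (wB k)).
have zm := mz c.
have : dl <= f by rewrite -dlE; nra.
move: zk zm; rewrite /= !mxE !ltr_norml /f => /andP[? ?] /andP[? ?] ?.
by apply/andP; split; lra.
Qed.
End ExtendedSolutions.

(** * Almost supermartingales with deterministic factors *)

Section AlmostSupermartingale.
Context {d : measure_display} {T : measurableType d} {R : realType}.
Variables (P : probability T R) (G : nat -> set (set T)).
Variables (W Th : nat -> T -> R) (b c : nat -> R) (Cb : R).
Hypothesis G_measurable : forall k, (G k).-sigma.-measurable `<=` @measurable d T.
Hypothesis G_nondecreasing : forall k,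
  (G k).-sigma.-measurable `<=` (G k.+1).-sigma.-measurable.
Hypothesis W_adapted : forall k,
  measurable_fun [set: g_sigma_algebraType (G k)] (W k).
Hypotheses (W_ge0 : forall k x, 0 <= W k x) (Th_ge0 : forall k x, 0 <= Th k x).
Hypotheses (W_integrable : forall k, P.-integrable setT (EFin \o W k))
  (Th_integrable : forall k, P.-integrable setT (EFin \o Th k)).
Hypotheses (b_ge0 : forall k, 0 <= b k) (c_ge0 : forall k, 0 <= c k).
Hypothesis b_summable : forall N, \sum_(0 <= k < N) b k <= Cb.
Hypothesis step : forall k A, (G k).-sigma.-measurable A ->
  \int[P]_(x in A) W k.+1 x + c k * \int[P]_(x in A) Th k x <=
  (1 + b k) * \int[P]_(x in A) W k x.

(* [W k / D k] is a supermartingale, and [D] is bounded. *)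
Let D k := \prod_(0 <= j < k) (1 + b j).

Let D_ge1 k : 1 <= D k.
Proof.
elim: k => [|k IH]; first by rewrite /D big_geq.
rewrite /D big_nat_recr//= -/(D k); have := b_ge0 k; nra.
Qed.

Let D_gt0 k : 0 < D k. Proof. exact: lt_le_trans (D_ge1 k). Qed.

Let D_le k : D k <= expR Cb.
Proof.
apply: (@le_trans _ _ (expR (\sum_(0 <= j < k) b j))); last by rewrite ler_expR.
elim: k => [|k IH]; first by rewrite /D !big_geq// expR0.
rewrite /D !big_nat_recr//= -/(D k) expRD.
by apply: ler_pM => //; [exact: ltW|rewrite addr_ge0|exact: expR_ge1Dx].
Qed.

Let D_S k : D k.+1 = D k * (1 + b k).
Proof. by rewrite /D big_nat_recr. Qed.

Let integrable_sub k A : measurable A -> P.-integrable A (EFin \o W k).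
Proof. by move=> mA; exact: integrableS (W_integrable k). Qed.

Lemma almost_supermartingale_cvg : {ae P, forall x, cvgn (W ^~ x)}.
Proof.
pose U k x := (D k)^-1 * W k x.
have iU k A : measurable A -> P.-integrable A (EFin \o U k).
  move=> mA; apply: (@integrableZl _ _ _ _ _ mA (D k)^-1 (EFin \o W k)).
  exact: integrable_sub.
have IU k A : measurable A ->
    \int[P]_(x in A) U k x = (D k)^-1 * \int[P]_(x in A) W k x.
  by move=> mA; apply: RintegralZl => //; exact: integrable_sub.
have Ucvg : {ae P, forall x, cvgn (U ^~ x)}.
  apply: (supermartingale_cvg P G) => // [k|k x|k|k A GA].
  - by apply: measurable_funM => //; exact: measurable_cst.
  - by rewrite mulr_ge0// invr_ge0 ltW.
  - exact: iU.
  - have mA := G_measurable _ _ GA.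
    rewrite !IU// D_S invfM -mulrA ler_wpM2l ?invr_ge0 ?(ltW (D_gt0 k))//.
    have b1 : 0 < 1 + b k by rewrite ltr_wpDr.
    rewrite ler_pdivrMl//.
    apply: le_trans (step _ _ GA); rewrite lerDl mulr_ge0//.
    exact: Rintegral_ge0.
have Dcvg : cvgn D.
  apply: nondecreasing_is_cvgn.
    apply/nondecreasing_seqP => k; rewrite D_S ler_peMr ?(ltW (D_gt0 k))//.
    by rewrite lerDl.
  by exists (expR Cb) => _ [k _ <-].
apply: filterS Ucvg => x Ux.
have -> : W ^~ x = (fun k => D k * U k x).
  by apply/funext => k; rewrite /U mulrA divff ?mul1r// gt_eqF.
exact: is_cvgM.
Qed.

(** Telescoping the normalised inequality bounds the sum of c_k E[Th_k]. If the residual stayed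
    above [e] from time [N] on with positive probability, those expectations would be bounded below
    and the sum would diverge with that of [c]. *)
Lemma residual_frequently_small :
  (forall M, exists N, M < \sum_(0 <= k < N) c k) ->
  {ae P, forall x, forall e N, 0 < e -> exists2 k, (N <= k)%N & Th k x < e}.
Proof.
move=> c_unbounded.
pose I0 := \int[P]_x W 0%N x.
have sum_le N : \sum_(0 <= k < N) c k * \int[P]_x Th k x <= expR Cb * I0.
  (* Each residual term carries its own factor [(D k.+1)^-1]; the uniform bound on [D] replaces them
     all by [(expR Cb)^-1]. *)
  have tele : (D N)^-1 * \int[P]_x W N x +
      (expR Cb)^-1 * \sum_(0 <= k < N) c k * \int[P]_x Th k x <= I0.
    elim: N => [|N IH]; first by rewrite /D !big_geq// invr1 mul1r mulr0 addr0.
    rewrite big_nat_recr//= mulrDr; apply: le_trans IH.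
    rewrite addrA addrAC lerD2r.
    have IT : 0 <= c N * \int[P]_x Th N x by rewrite mulr_ge0// Rintegral_ge0.
    apply: (@le_trans _ _ ((D N.+1)^-1 *
        (\int[P]_x W N.+1 x + c N * \int[P]_x Th N x))).
      rewrite mulrDr lerD2l ler_wpM2r// lef_pV2 ?posrE ?expR_gt0//.
    have := step N setT (@measurableT _ (g_sigma_algebraType (G N))).
    rewrite -(ler_pM2l (_ : 0 < (D N.+1)^-1)) ?invr_gt0// => /le_trans; apply.
    by rewrite D_S invfM -mulrA mulKf// gt_eqF// ltr_wpDr.
  rewrite -ler_pdivrMl ?expR_gt0//; apply: le_trans tele.
  by rewrite lerDr mulr_ge0 ?invr_ge0 ?(ltW (D_gt0 N))// Rintegral_ge0.
have mTh k : measurable_fun setT (Th k).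
  by apply/measurable_EFinP; exact: measurable_int (Th_integrable k).
suff large_null m : {ae P, forall x, forall N,
    exists2 k, (N <= k)%N & Th k x < m.+1%:R^-1}.
  have := @ae_foralln _ _ _ P _ large_null; apply: filterS => x h e N e0.
  have [m _ hm] := near_infty_natSinv_lt (PosNum e0).
  have [k Nk Tk] := h m N; exists k => //; apply: lt_trans Tk _.
  exact: (hm m (leqnn m)).
apply: ae_foralln => N; set e := _^-1.
have e0 : 0 < e by rewrite invr_gt0.
pose E := \bigcap_(k in [set k | (N <= k)%N]) [set x | e <= Th k x].
have mE : measurable E.
  apply: bigcap_measurable => [|k _]; first by exists N => /=.
  have := @measurable_fun_ler _ _ _ setT (cst e) (Th k) (measurable_cst _) (mTh k).
  by move=> /(_ measurableT [set true] I); rewrite setTI.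
exists E; split=> //; last first.
  move=> x /= nx k /= Nk; rewrite leNgt; apply/negP => Tk; apply: nx; by exists k.
rewrite -[LHS]fineK ?fin_num_measure//; congr EFin.
apply: contrapT => /eqP PE0.
have PE : 0 < fine (P E) by rewrite lt_neqAle eq_sym PE0 fine_ge0.
have ETh k : (N <= k)%N -> e * fine (P E) <= \int[P]_x Th k x.
  move=> Nk; rewrite -Rintegral_cst//.
  apply: (@le_trans _ _ (\int[P]_(x in E) Th k x)).
    apply: le_Rintegral => //; first exact: finite_measure_integrable_cst.
      exact: integrableS (Th_integrable k).
    by move=> x /(_ k Nk).
  rewrite -(setvU E) Rintegral_setU//.
  - by rewrite lerDr Rintegral_ge0.
  - exact: measurableC.
  - by rewrite setvU.
  - by apply/disj_setPS => x [].
(* The lower bound [ETh] holds only from [N] on, so the head of the sum is added to the threshold to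
   make the tail exceed the quotient. *)
have [N' hN'] := c_unbounded (\sum_(0 <= k < N) c k + expR Cb * I0 / (e * fine (P E))).
have eP : 0 < e * fine (P E) by rewrite mulr_gt0.
have := sum_le N'.
suff : expR Cb * I0 < \sum_(0 <= k < N') c k * \int[P]_x Th k x by rewrite ltNge => /negP.
have NN' : (N <= N')%N.
  rewrite leqNgt; apply/negP => N'N; move: hN'.
  rewrite (big_cat_nat (n := N'))//=; last exact: ltnW.
  rewrite -addrA ltNge lerDl addr_ge0 ?sumr_ge0//.
  rewrite divr_ge0 ?(ltW eP)// mulr_ge0 ?expR_ge0//.
  exact: Rintegral_ge0.
move: hN'; rewrite [ltRHS](big_cat_nat (n := N))//= ltrD2l ltr_pdivrMr//.
move=> /lt_le_trans; apply.
rewrite [leRHS](big_cat_nat (n := N))//=.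
apply: (@le_trans _ _ (\sum_(N <= k < N') c k * \int[P]_x Th k x)); last first.
  by rewrite lerDr sumr_ge0// => k _; rewrite mulr_ge0// Rintegral_ge0.
rewrite mulr_suml big_nat_cond [leRHS]big_nat_cond; apply: ler_sum => k.
by rewrite andbT => /andP[Nk _]; rewrite ler_wpM2l// ETh.
Qed.
End AlmostSupermartingale.

(** * Random vectors and conditional moments *)

Section RandomVectors.
Context {dS : measure_display} {S : measurableType dS} {R : realType} {d : nat}.
Implicit Types u v : S -> 'rV[R]_d.

Lemma random_vectorD u v : random_vector u -> random_vector v ->
  random_vector (fun s => u s + v s).
Proof.
move=> mu mv c; under eq_fun do rewrite mxE; exact: measurable_funD.
Qed.

Lemma random_vectorZ (a : R) u : random_vector u -> random_vector (fun s => a *: u s).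
Proof.
by move=> mu c; under eq_fun do rewrite mxE; apply: measurable_funM.
Qed.

Lemma random_vectorB u v : random_vector u -> random_vector v ->
  random_vector (fun s => u s - v s).
Proof.
move=> mu mv; apply: random_vectorD => //.
by under eq_fun do rewrite -scaleN1r; exact: random_vectorZ.
Qed.

Lemma random_vector_cst (a : 'rV[R]_d) : random_vector (fun _ : S => a).
Proof. by move=> c; exact: measurable_cst. Qed.

Lemma random_vector_sum {J : Type} (r : seq J) (u : J -> S -> 'rV[R]_d) :
  (forall j, random_vector (u j)) -> random_vector (fun s => \sum_(j <- r) u j s).
Proof.
move=> mu c; under eq_fun do rewrite summxE.
by apply: measurable_sum => j; exact: mu.
Qed.

Lemma random_vector_lipschitz (K : R) u v : random_vector u ->
  (forall a b, enorm (v a - v b) <= K * enorm (u a - u b)) -> 0 <= K ->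
  random_vector v.
Proof.
move=> mu vu K0 c.
apply: (measurable_fun_lipschitz (fun s j => u s ord0 j) _ K) => // a b.
have := coord_le_enorm (v a - v b) c; rewrite !mxE => /le_trans; apply.
apply: le_trans (vu a b) _; rewrite ler_wpM2l//.
apply: le_trans (enorm_le_norm1 _) _.
by under eq_bigr do rewrite !mxE.
Qed.

Lemma measurable_dotp u v : random_vector u -> random_vector v ->
  measurable_fun setT (fun s => dotp (u s) (v s)).
Proof.
by move=> mu mv; apply: measurable_sum => c; exact: measurable_funM.
Qed.
End RandomVectors.

Section ConditionalMoments.
Context {dT : measure_display} {T : measurableType dT} {R : realType} {d : nat}.
Variable P : probability T R.

Lemma Rintegral_sum {J : Type} (r : seq J) (f : J -> T -> R) A : measurable A ->
  (forall j, P.-integrable A (EFin \o f j)) ->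
  P.-integrable A (EFin \o (fun x => \sum_(j <- r) f j x)) /\
  \int[P]_(x in A) \sum_(j <- r) f j x = \sum_(j <- r) \int[P]_(x in A) f j x.
Proof.
move=> mA intf; elim: r => [|j r [IH1 IH2]].
  rewrite big_nil; split.
    apply: (eq_integrable mA (cst 0%E)) => [x _ /=|]; first by rewrite big_nil.
    exact: integrable0.
  by under eq_Rintegral do rewrite big_nil; rewrite Rintegral_cst// mul0r.
split.
  pose g x := \sum_(j <- r) f j x.
  apply: (eq_integrable mA ((EFin \o f j) \+ (EFin \o g))%E).
    by move=> x _ /=; rewrite big_cons.
  exact: integrableD.
under eq_Rintegral do rewrite big_cons.
by rewrite RintegralD// big_cons IH2.
Qed.

(** On an event of [G] the integral of |X|^2 equals that of the version [Y], which lies below [U]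
    almost everywhere. The whole space as event yields integrability. *)
Lemma cond_sq_bound_integral (G : set (set T)) (X : T -> 'rV[R]_d) (U : T -> R) A :
  G `<=` measurable -> random_vector X -> measurable_fun setT U ->
  (forall x, 0 <= U x) -> cond_sq_bound P G X U ->
  P.-integrable setT (EFin \o U) -> G setT -> G A ->
  P.-integrable setT (EFin \o (fun x => dotp (X x) (X x))) /\
  \int[P]_(x in A) dotp (X x) (X x) <= \int[P]_(x in A) U x.
Proof.
move=> Gm mX mU U0 [Y [[mY [Y0 XY]] YU]] iU GT GA.
have mYT : measurable_fun setT Y by move=> _ B mB; rewrite setTI; exact/Gm/mY.
have mX2 : measurable_fun setT (fun x => dotp (X x) (X x)) by exact: measurable_dotp.
have le_int D : G D -> (\int[P]_(x in D) (dotp (X x) (X x))%:E <=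
    \int[P]_(x in D) (U x)%:E)%E.
  move=> GD; have mD := Gm _ GD.
  under eq_integral do rewrite -sqr_enorm.
  rewrite XY//; apply: ae_ge0_le_integral => //.
  - exact: measurable_funTS.
  - by move=> x _; rewrite lee_fin.
  - by apply/measurable_EFinP; exact: measurable_funTS.
  - by apply: filterS YU => x + _.
have iX : P.-integrable setT (EFin \o (fun x => dotp (X x) (X x))).
  apply/integrableP; split; first exact/measurable_EFinP.
  under eq_integral do rewrite /= ger0_norm ?dotp_ge0//.
  apply: le_lt_trans (le_int _ GT) _.
  by rewrite ltey_eq (integrable_fin_num _ iU).
have mA := Gm _ GA.
split=> //; rewrite -lee_fin.
have finI f : P.-integrable setT (EFin \o f) ->
    ((\int[P]_(x in A) f x)%:E = \int[P]_(x in A) (f x)%:E)%E.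
  move=> intf; rewrite fineK//; apply: integrable_fin_num => //.
  exact: (integrableS measurableT).
by rewrite !finI//; exact: le_int.
Qed.

(** Square integrability of both factors makes each coordinate product integrable, since |ab| <= a^2
    + b^2; orthogonality then applies coordinate by coordinate. *)
Lemma cond_mean_zero_dotp (G : set (set T)) (X h : T -> 'rV[R]_d) A :
  G.-sigma.-measurable `<=` @measurable _ T -> random_vector X ->
  cond_mean_zero P (G.-sigma.-measurable) X ->
  @random_vector _ (g_sigma_algebraType G) R d h ->
  P.-integrable setT (EFin \o (fun x => dotp (X x) (X x))) ->
  P.-integrable setT (EFin \o (fun x => dotp (h x) (h x))) ->
  G.-sigma.-measurable A ->
  P.-integrable setT (EFin \o (fun x => dotp (X x) (h x))) /\
  \int[P]_(x in A) dotp (X x) (h x) = 0.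
Proof.
move=> Gm mX X0 mh iX ih GA.
have mA := Gm _ GA.
have mhT c : measurable_fun setT (fun x => h x ord0 c).
  exact: (sub_sigma_measurable_fun G Gm).
have ic c : P.-integrable setT (EFin \o (fun x => X x ord0 c * h x ord0 c)).
  apply: (@le_Rintegrable _ _ _ _ _ _
    (fun x => dotp (X x) (X x) + dotp (h x) (h x))) => //.
  - exact: measurable_funM.
  - exact: (integrableD measurableT iX ih).
  - move=> x _; have := sqr_coord_le (X x) c; have := sqr_coord_le (h x) c.
    move: (X x ord0 c) (h x ord0 c) => a b ha hb.
    have := sqr_ge0 (a - b); have := sqr_ge0 (a + b).
    by rewrite ler_norml; nra.
have [iS _] := Rintegral_sum (index_enum 'I_d) _ _ measurableT ic.
split=> //.
have [_ ->] := Rintegral_sum (index_enum 'I_d) _ _ mA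
  (fun c => integrableS measurableT mA (@subsetT _ _) (ic c)).
apply: big1 => c _.
have [_ [iXc [_ X0c]]] := X0 c.
apply: (orthogonal_measurable P G (fun x => X x ord0 c) Gm iXc) => //.
move=> D GD; rewrite /Rintegral X0c//.
by under eq_integral do rewrite /=; rewrite integral0.
exact: ic.
Qed.
End ConditionalMoments.

Section GeneratedByVectors.
Context {dT : measure_display} {T : measurableType dT} {R : realType} {d : nat}.
Implicit Types Xs Ys : set (T -> 'rV[R]_d).

(* The generators in [gen_sigma_vec Xs], which is convertible to
   [<<s coord_preimages Xs>>]. *)
Definition coord_preimages Xs : set (set T) :=
  [set D | exists f, (exists X, Xs X /\ exists c : 'I_d, f = fun om => X om ord0 c) /\
    exists S : set R, measurable S /\ D = f @^-1` S].

Lemma coord_preimages_random_vector Xs X : Xs X ->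
  @random_vector _ (g_sigma_algebraType (coord_preimages Xs)) R d X.
Proof.
move=> XsX c _ S mS; rewrite setTI; apply: sub_sigma_algebra.
exists (fun om => X om ord0 c); split; last by exists S.
by exists X; split=> //; exists c.
Qed.

Lemma coord_preimages_measurable Xs : (forall X, Xs X -> random_vector X) ->
  (coord_preimages Xs).-sigma.-measurable `<=` @measurable _ T.
Proof.
move=> mXs; apply: smallest_sub; first exact: sigma_algebra_measurable.
move=> _ [_ [[X [XsX [c ->]]] [S [mS ->]]]].
by rewrite -[X in measurable X]setTI; exact: mXs.
Qed.

Lemma coord_preimages_sub Xs Ys : Xs `<=` Ys ->
  (coord_preimages Xs).-sigma.-measurable `<=` (coord_preimages Ys).-sigma.-measurable.
Proof.
move=> XY; apply: sub_sigma_algebra2 => D [f [[X [/XY YX fX]] SD]].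
by exists f; split=> //; exists X.
Qed.

Lemma RintegralD_scale (P : probability T R) (f g : T -> R) (a : R) D :
  measurable D ->
  P.-integrable setT (EFin \o f) -> P.-integrable setT (EFin \o g) ->
  P.-integrable setT (EFin \o (fun x => f x + a * g x)) /\
  \int[P]_(x in D) (f x + a * g x) = \int[P]_(x in D) f x + a * \int[P]_(x in D) g x.
Proof.
move=> mD intf intg.
have intag : P.-integrable setT (EFin \o (fun x => a * g x)).
  exact: (integrableZl measurableT a intg).
split; first exact: (integrableD measurableT intf intag).
rewrite RintegralD//; try exact: (integrableS measurableT).
by rewrite RintegralZl//; exact: (integrableS measurableT).
Qed.
End GeneratedByVectors.

Lemma nneseries_bounded {R : realType} (a : nat -> R) : (forall k, 0 <= a k) ->
  (\sum_(k <oo) (a k)%:E < +oo)%E ->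
  exists C, forall N, \sum_(0 <= k < N) a k <= C.
Proof.
move=> a0 afin; exists (fine (\sum_(k <oo) (a k)%:E)%E) => N.
rewrite -lee_fin fineK; last first.
  by rewrite ge0_fin_numE//; apply: nneseries_ge0 => k _ _; rewrite lee_fin.
by rewrite -sumEFin; apply: nneseries_lim_ge => k _ _; rewrite lee_fin.
Qed.

Lemma nneseries_unbounded {R : realType} (a : nat -> R) : (forall k, 0 <= a k) ->
  (\sum_(k <oo) (a k)%:E = +oo)%E ->
  forall M, exists N, M < \sum_(0 <= k < N) a k.
Proof.
move=> a0 ainf M; apply: contrapT => h.
have : (\sum_(k <oo) (a k)%:E <= M%:E)%E.
  apply: lime_le; first by apply: is_cvg_nneseries => k _ _; rewrite lee_fin.
  apply: nearW => N; rewrite sumEFin lee_fin leNgt; apply/negP => MN.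
  by apply: h; exists N.
by rewrite ainf leye_eq.
Qed.

(** * Stochastic projective splitting *)

Section StochasticProjectiveSplitting.
Context {R : realType} {dT : measure_display} {T : measurableType dT}.
Variable P : probability T R.
Context {n d : nat}.
Variables (A : 'I_n -> 'rV[R]_d -> set 'rV[R]_d) (B : 'rV[R]_d -> 'rV[R]_d).
Variables (L tau rhobar N1 N2 N3 N4 : R) (alpha rho : nat -> R).
Hypotheses (A_max : forall i, maximal_monotone (A i)) (B_mono : monotone_fun B)
  (L_gt0 : 0 < L) (B_lip : lipschitz_with L B) (tau_gt0 : 0 < tau).
Hypotheses (alpha_gt0 : forall k, 0 < alpha k) (rho_gt0 : forall k, 0 < rho k)
  (rho_le : forall k, rho k <= rhobar) (rhobar_lt : rhobar < L^-1).
Hypotheses (N1_ge0 : 0 <= N1) (N2_ge0 : 0 <= N2) (N3_ge0 : 0 <= N3) (N4_ge0 : 0 <= N4).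
Variables (z : nat -> T -> 'rV[R]_d) (w : nat -> 'I_n -> T -> 'rV[R]_d)
  (wB : nat -> T -> 'rV[R]_d) (x : nat -> 'I_n -> T -> 'rV[R]_d)
  (eps e : nat -> T -> 'rV[R]_d).
Hypotheses (eps_rv : forall k, random_vector (eps k))
  (e_rv : forall k, random_vector (e k)).
Variables (z1 : 'rV[R]_d) (w1 : 'I_n -> 'rV[R]_d) (wB1 : 'rV[R]_d).
Hypothesis w1_sum : \sum_(i < n) w1 i + wB1 = 0.
Hypothesis init : forall om,
  z 0%N om = z1 /\ (forall i, w 0%N i om = w1 i) /\ wB 0%N om = wB1.
Hypothesis x_resolvent : forall k i om,
  resolvent_rel tau (A i) (z k om + tau *: w k i om) (x k i om).

Let y k i om : 'rV[R]_d := tau^-1 *: (z k om + tau *: w k i om - x k i om).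
Let xB k om : 'rV[R]_d := z k om - rho k *: (B (z k om) + eps k om - wB k om).
Let yB k om : 'rV[R]_d := B (xB k om) + e k om.
Let xbar k om : 'rV[R]_d := (n.+1)%:R^-1 *: (\sum_(i < n) x k i om + xB k om).

Hypothesis z_step : forall k om,
  z k.+1 om = z k om - alpha k *: (\sum_(i < n) y k i om + yB k om).
Hypothesis w_step : forall k i om,
  w k.+1 i om = w k i om - alpha k *: (x k i om - xbar k om).
Hypothesis wB_step : forall k om,
  wB k.+1 om = wB k om - alpha k *: (xB k om - xbar k om).

Let t_split k i om : z k om + tau *: w k i om = x k i om + tau *: y k i om.
Proof. by rewrite /y scalerA mulfV ?gt_eqF// scale1r [RHS]addrC subrK. Qed.

Let A_xy k i om : A i (x k i om) (y k i om).
Proof.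
have [a [Axa ta]] := x_resolvent k i om.
by rewrite /y ta addrC addKr scalerA mulVf ?gt_eqF// scale1r.
Qed.

(** [xbar] is the mean of the n+1 points, so the dual increments add up to zero. *)
Let w_sum k om : \sum_(i < n) w k i om + wB k om = 0.
Proof.
elim: k => [|k IH].
  have [_ [w0 ->]] := init om; rewrite -[RHS]w1_sum; congr (_ + _).
  by apply: eq_bigr => i _; exact: w0.
under eq_bigr do rewrite w_step; rewrite wB_step sumrB -scaler_sumr addrACA IH add0r.
rewrite -opprD -scalerDr sumrB sumr_const card_ord addrACA -opprD -mulrSr.
by rewrite /xbar -scaler_nat scalerA mulfV ?pnatr_eq0// scale1r subrr scaler0 oppr0.
Qed.

Let rhobar_gt0 : 0 < rhobar. Proof. exact: lt_le_trans (rho_gt0 0) (rho_le 0). Qed.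

Let rhobarL : rhobar * L < 1.
Proof. by rewrite -ltr_pdivlMr// mul1r. Qed.

(** The resolvent enters only as a relation; by contraction [x] is nevertheless a 1-Lipschitz
    function of [t] along the values taken, hence measurable. *)
Let x_rv k : random_vector (z k) -> (forall i, random_vector (w k i)) ->
  forall i, random_vector (x k i).
Proof.
move=> mz mw i.
apply: (random_vector_lipschitz 1 (fun om => z k om + tau *: w k i om)) => //.
  by apply: random_vectorD => //; exact: random_vectorZ.
move=> a b; rewrite mul1r -ler_sqr ?nnegrE ?enorm_ge0// !sqr_enorm !t_split.
apply: le_trans (resolvent_contraction (A i) tau _ _ _ _ tau_gt0 (A_max i).1
  (A_xy k i a) (A_xy k i b)).
by rewrite lerDl mulr_ge0 ?sqr_ge0 ?dotp_ge0.
Qed.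

Let iterates_rv k :
  [/\ random_vector (z k), forall i, random_vector (w k i) & random_vector (wB k)].
Proof.
have eq_rv (u v : T -> 'rV[R]_d) : (forall om, u om = v om) ->
    random_vector v -> random_vector u by move=> /funext ->.
elim: k => [|k [mz mw mwB]].
  split=> [|i|].
  - rewrite (_ : z 0%N = fun=> z1); first exact: random_vector_cst.
    by apply/funext => om; case: (init om).
  - rewrite (_ : w 0%N i = fun=> w1 i); first exact: random_vector_cst.
    by apply/funext => om; case: (init om) => _ [].
  - rewrite (_ : wB 0%N = fun=> wB1); first exact: random_vector_cst.
    by apply/funext => om; case: (init om) => _ [].
have mx := x_rv k mz mw.
have mB (u : T -> 'rV[R]_d) : random_vector u -> random_vector (fun om => B (u om)).
  move=> mu; apply: (random_vector_lipschitz L u) => //; exact: ltW.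
have mxB : random_vector (xB k).
  apply: random_vectorB => //; apply: random_vectorZ.
  by apply: random_vectorB => //; apply: random_vectorD => //; exact: mB.
have mxbar : random_vector (xbar k).
  apply: (random_vectorZ _ (fun om => \sum_(i < n) x k i om + xB k om)).
  by apply: random_vectorD => //; exact: random_vector_sum.
split=> [|i|].
- apply: (eq_rv _ _ (z_step k)).
  apply: random_vectorB => //; apply: random_vectorZ; apply: random_vectorD.
    apply: random_vector_sum => i; apply: random_vectorZ; apply: random_vectorB => //.
    by apply: random_vectorD => //; exact: random_vectorZ.
  by apply: random_vectorD => //; exact: mB.
- apply: (eq_rv _ _ (fun om => w_step k i om)).
  by apply: random_vectorB => //; apply: random_vectorZ; exact: random_vectorB.
- apply: (eq_rv _ _ (wB_step k)).
  by apply: random_vectorB => //; apply: random_vectorZ; exact: random_vectorB.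
Qed.

(** * Growth bounds and the pathwise descent inequality *)

Section Descent.
Variable p : 'rV[R]_d * ('I_n -> 'rV[R]_d).
Hypothesis p_sol : extended_solution A B p.

Let V k om := sqr_dist B p (z k om) (w k ^~ om) (wB k om).
(** The weights follow the order in which the noise enters: [M0] bounds what precedes step k, [M1]
    also xB, which contains eps, and [M2] also yB, which contains e. Pairing [k] with [om] makes the
    constants uniform in both. *)
Let M0 (s : nat * T) : R := 1 + V s.1 s.2.
Let M1 (s : nat * T) : R := M0 s + dotp (eps s.1 s.2) (eps s.1 s.2).
Let M2 (s : nat * T) : R := M1 s + dotp (e s.1 s.2) (e s.1 s.2).

Let V_ge0 k om : 0 <= V k om.
Proof. by case: (sqr_dist_ge B p (z k om) (w k ^~ om) (wB k om)). Qed.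

Let M0_ge1 s : 1 <= M0 s. Proof. by rewrite lerDl V_ge0. Qed.
Let M01 s : M0 s <= M1 s. Proof. by rewrite lerDl dotp_ge0. Qed.
Let M12 s : M1 s <= M2 s. Proof. by rewrite lerDl dotp_ge0. Qed.
Let M1_ge1 s : 1 <= M1 s. Proof. exact: le_trans (M01 s). Qed.
Let M2_ge1 s : 1 <= M2 s. Proof. exact: le_trans (M12 s). Qed.

Let ge0_of_ge1 (M : nat * T -> R) : (forall s, 1 <= M s) -> forall s, 0 <= M s.
Proof. by move=> M1' s; exact: le_trans (M1' s). Qed.

Let dom_z : sqr_dominated M0 (fun s => z s.1 s.2).
Proof.
apply: (sqr_dominated_dist _ _ p.1) => //; exists 1 => // -[k om] /=.
have [h _ _ _] := sqr_dist_ge B p (z k om) (w k ^~ om) (wB k om).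
by rewrite mul1r (le_trans h)// lerDr.
Qed.

Let dom_w i : sqr_dominated M0 (fun s => w s.1 i s.2).
Proof.
apply: (sqr_dominated_dist _ _ (p.2 i)) => //; exists 1 => // -[k om] /=.
have [_ h _ _] := sqr_dist_ge B p (z k om) (w k ^~ om) (wB k om).
by rewrite mul1r (le_trans (h i))// lerDr.
Qed.

Let dom_wB : sqr_dominated M0 (fun s => wB s.1 s.2).
Proof.
apply: (sqr_dominated_dist _ _ (B p.1)) => //; exists 1 => // -[k om] /=.
have [_ _ h _] := sqr_dist_ge B p (z k om) (w k ^~ om) (wB k om).
by rewrite mul1r (le_trans h)// lerDr.
Qed.

Let dom_Bz : sqr_dominated M0 (fun s => B (z s.1 s.2)).
Proof. exact: sqr_dominated_lipschitz B_lip dom_z. Qed.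

Let dom_scale (M : nat * T -> R) (a : R) (f : nat * T -> 'rV[R]_d) :
  (forall s, 1 <= M s) ->
  sqr_dominated M f -> sqr_dominated M (fun s => a *: f s).
Proof.
move=> M1' hf; apply: (sqr_dominatedZ _ (fun=> a) `|a|) => //.
exact: ge0_of_ge1.
Qed.

(** The point [p.1] is the resolvent of [p.1 + tau *: p.2 i], so contraction applies to this
    pair. *)
Let dom_x i : sqr_dominated M0 (fun s => x s.1 i s.2).
Proof.
apply: (sqr_dominated_dist _ _ p.1) => //.
have [C C0 hC] : sqr_dominated M0
    (fun s => (z s.1 s.2 + tau *: w s.1 i s.2) - (p.1 + tau *: p.2 i)).
  apply: sqr_dominatedB; last exact: sqr_dominated_cst.
  by apply: sqr_dominatedD => //; exact: dom_scale.
exists C => // -[k om]; apply: le_trans (hC (k, om)); rewrite /= t_split.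
apply: le_trans (resolvent_contraction (A i) tau _ _ _ _ tau_gt0 (A_max i).1
  (A_xy k i om) (p_sol.1 i)).
by rewrite lerDl mulr_ge0 ?sqr_ge0 ?dotp_ge0.
Qed.

Let dom_y i : sqr_dominated M0 (fun s => y s.1 i s.2).
Proof.
apply: dom_scale => //; apply: sqr_dominatedB => //.
by apply: sqr_dominatedD => //; exact: dom_scale.
Qed.

Let dom_xB : sqr_dominated M1 (fun s => xB s.1 s.2).
Proof.
have lift (f : nat * T -> 'rV[R]_d) : sqr_dominated M0 f -> sqr_dominated M1 f.
  exact: sqr_dominated_le.
apply: sqr_dominatedB; first exact: lift.
apply: (sqr_dominatedZ _ (fun s => rho s.1) rhobar); first exact: ge0_of_ge1.
  by move=> s; rewrite gtr0_norm.
apply: sqr_dominatedB; last exact: lift.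
apply: sqr_dominatedD; first exact: lift.
exists 1 => // s; rewrite mul1r /M1 lerDr.
exact: le_trans (M0_ge1 s).
Qed.

Lemma oracle_growth : exists2 C, 0 <= C & forall k om,
  enorm (B (xB k om)) ^+ 2 <= C * (1 + V k om + dotp (eps k om) (eps k om)).
Proof.
have [C C0 hC] := sqr_dominated_lipschitz _ _ _ _ M1_ge1 B_lip dom_xB.
by exists C => // k om; rewrite sqr_enorm; exact: (hC (k, om)).
Qed.

Lemma solution_growth : exists2 C, 0 <= C & forall k om,
  enorm (B (z k om)) ^+ 2 <= C * (1 + V k om).
Proof.
have [C C0 hC] := dom_Bz.
by exists C => // k om; rewrite sqr_enorm; exact: (hC (k, om)).
Qed.

(** This is the squared length of the search direction, the coefficient of alpha_k^2 when the new
    distance is expanded. *)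
Lemma increment_growth : exists2 C, 0 <= C & forall k om,
  dotp (\sum_(i < n) y k i om + yB k om) (\sum_(i < n) y k i om + yB k om)
  + \sum_(i < n) dotp (x k i om - xbar k om) (x k i om - xbar k om)
  + dotp (xB k om - xbar k om) (xB k om - xbar k om) <=
  C * (1 + V k om + dotp (eps k om) (eps k om) + dotp (e k om) (e k om)).
Proof.
have lift1 (f : nat * T -> 'rV[R]_d) : sqr_dominated M1 f -> sqr_dominated M2 f.
  exact: sqr_dominated_le.
have lift (f : nat * T -> 'rV[R]_d) : sqr_dominated M0 f -> sqr_dominated M2 f.
  by move=> hf; apply: lift1; exact: sqr_dominated_le hf.
have [C1 C10 h1] : sqr_dominated M2
    (fun s => \sum_(i < n) y s.1 i s.2 + yB s.1 s.2).
  apply: sqr_dominatedD.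
    by apply: sqr_dominated_sum => i; exact: lift.
  apply: sqr_dominatedD.
    by apply: lift1; exact: sqr_dominated_lipschitz B_lip dom_xB.
  by exists 1 => // s; rewrite mul1r /M2 lerDr; exact: le_trans (M1_ge1 s).
have hbar : sqr_dominated M2 (fun s => xbar s.1 s.2).
  apply: dom_scale => //; apply: sqr_dominatedD; last exact: lift1.
  by apply: sqr_dominated_sum => i; exact: lift.
have [C3 C30 h3] : sqr_dominated M2 (fun s => xB s.1 s.2 - xbar s.1 s.2).
  by apply: sqr_dominatedB => //; exact: lift1.
have /choice[C2 hC2] : forall i, exists C, 0 <= C /\ forall s,
    dotp (x s.1 i s.2 - xbar s.1 s.2) (x s.1 i s.2 - xbar s.1 s.2) <= C * M2 s.
  move=> i; have [C C0 hC] : sqr_dominated M2 (fun s => x s.1 i s.2 - xbar s.1 s.2).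
    by apply: sqr_dominatedB => //; exact: lift.
  by exists C.
exists (C1 + \sum_(i < n) C2 i + C3).
  by rewrite !addr_ge0// sumr_ge0// => i _; case: (hC2 i).
move=> k om; rewrite -/(M2 (k, om)) !mulrDl mulr_suml.
apply: lerD; last exact: (h3 (k, om)).
apply: lerD; first exact: (h1 (k, om)).
by apply: ler_sum => i _; case: (hC2 i) => _ /(_ (k, om)).
Qed.

Definition residual k om := \sum_(i < n) dotp (z k om - x k i om) (z k om - x k i om)
  + dotp (B (z k om) - wB k om) (B (z k om) - wB k om).

Definition noise_term k om :=
  - 2 * alpha k * (rho k - 2 * L * rho k ^+ 2)
    * dotp (eps k om) (B (z k om) - wB k om)
  - 2 * alpha k * dotp (e k om) (z k om - p.1).

(* [noise_term] is linear in the noise against quantities known before step [k], so it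
   integrates to zero; [kappa] survives because [rho k <= rhobar < 1 / L]. *)
Lemma descent : exists2 kappa, 0 < kappa & exists2 C, 0 <= C & forall k om,
  V k.+1 om + 2 * kappa * (alpha k * rho k) * residual k om <=
  V k om + noise_term k om
  + 2 * L * (alpha k * rho k ^+ 2) * dotp (eps k om) (eps k om)
  + C * alpha k ^+ 2 *
    (1 + V k om + dotp (eps k om) (eps k om) + dotp (e k om) (e k om)).
Proof.
(* The first entry gives kappa rho_k <= 1/tau for the resolvent part of the residual, the second
   kappa <= 1 - rho_k L for the part of [B]. *)
pose kappa := Num.min ((tau * rhobar)^-1) (1 - rhobar * L).
have kappa0 : 0 < kappa.
  by rewrite lt_min invr_gt0 mulr_gt0//= subr_gt0.
have kappa1 : kappa * rhobar <= tau^-1.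
  have : kappa <= (tau * rhobar)^-1 by rewrite ge_min lexx.
  by rewrite invfM -ler_pdivlMr.
have kappa2 : kappa <= 1 - rhobar * L by rewrite ge_min lexx orbT.
exists kappa => //.
have [C C0 hC] := increment_growth; exists C => // k om.
have := separation_bound A B L tau (rho k) (z k om) (wB k om) (eps k om) (e k om)
  (xB k om) (xbar k om) p.1 (w k ^~ om) (x k ^~ om) (y k ^~ om) p.2
  (fun i => (A_max i).1) B_mono L_gt0 B_lip tau_gt0 (fun i => A_xy k i om)
  (fun i => t_split k i om) (w_sum k om) p_sol.1 p_sol.2 (erefl _).
rewrite -/(yB k om).
set D := (X in _ <= X) => sepD.
have VS : V k.+1 om = V k om - 2 * alpha k * D + alpha k ^+ 2 *
  (dotp (\sum_(i < n) y k i om + yB k om) (\sum_(i < n) y k i om + yB k om)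
  + \sum_(i < n) dotp (x k i om - xbar k om) (x k i om - xbar k om)
  + dotp (xB k om - xbar k om) (xB k om - xbar k om)).
  have sqE (u v c : 'rV[R]_d) : dotp (u - alpha k *: v - c) (u - alpha k *: v - c) =
      dotp (u - c) (u - c) - 2 * alpha k * dotp v (u - c) + alpha k ^+ 2 * dotp v v.
    rewrite addrAC; move: (u - c) => a.
    by rewrite !dotpE (dotpC a v); ring.
  have sumE : \sum_(i < n) dotp (w k.+1 i om - p.2 i) (w k.+1 i om - p.2 i) =
      \sum_(i < n) dotp (w k i om - p.2 i) (w k i om - p.2 i)
      - 2 * alpha k * \sum_(i < n) dotp (x k i om - xbar k om) (w k i om - p.2 i)
      + alpha k ^+ 2
        * \sum_(i < n) dotp (x k i om - xbar k om) (x k i om - xbar k om).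
    under eq_bigr do rewrite w_step sqE.
    by rewrite !big_split/= sumrN -!mulr_sumr.
  by rewrite /V /sqr_dist z_step wB_step !sqE sumE /D; ring.
have := hC k om; set N := (X in X <= _) => hN.
rewrite VS -/N.
have a0 := alpha_gt0 k; have r0 := rho_gt0 k; have rr := rho_le k.
have S0 := sum_dotp_ge0 (fun i => z k om - x k i om).
have Q0 := dotp_ge0 (B (z k om) - wB k om).
have N_le : alpha k ^+ 2 * N <= C * alpha k ^+ 2 *
    (1 + V k om + dotp (eps k om) (eps k om) + dotp (e k om) (e k om)).
  by rewrite (mulrC C) -[leRHS]mulrA ler_wpM2l ?sqr_ge0.
have res_le : kappa * rho k * residual k om <=
    tau^-1 * (\sum_(i < n) dotp (z k om - x k i om) (z k om - x k i om))
    + rho k * (1 - rho k * L) * dotp (B (z k om) - wB k om) (B (z k om) - wB k om).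
  rewrite /residual mulrDr; apply: lerD; rewrite ler_wpM2r//.
    by apply: le_trans kappa1; rewrite ler_pM2l.
  rewrite mulrC ler_pM2l//; apply: le_trans kappa2 _.
  by rewrite lerD2l lerN2 ler_pM2r.
have aD : 2 * alpha k * (kappa * rho k * residual k om
    + (rho k - 2 * L * rho k ^+ 2) * dotp (eps k om) (B (z k om) - wB k om)
    - L * rho k ^+ 2 * dotp (eps k om) (eps k om) + dotp (e k om) (z k om - p.1))
    <= 2 * alpha k * D.
  rewrite ler_wpM2l//; first by rewrite mulr_ge0// ltW.
  by apply: le_trans sepD; lra.
rewrite /noise_term; lra.
Qed.
End Descent.

Let history k : set (T -> 'rV[R]_d) := [set X | exists j, (j <= k)%N /\
  (X = z j \/ (exists i, X = w j i) \/ X = wB j)].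
Let F k := coord_preimages (history k).
Let FE k := coord_preimages (history k `|` [set eps k]).

Hypothesis noise : forall k,
  cond_mean_zero P (F k).-sigma.-measurable (eps k) /\
  cond_mean_zero P (F k).-sigma.-measurable (e k) /\
  cond_sq_bound P (F k).-sigma.-measurable (eps k)
    (fun om => N1 + N2 * enorm (B (z k om)) ^+ 2) /\
  cond_sq_bound P (FE k).-sigma.-measurable (e k)
    (fun om => N3 + N4 * enorm (B (xB k om)) ^+ 2).

Let history_rv k X : history k X -> random_vector X.
Proof.
by move=> [j [_ [->|[[i ->]|->]]]]; case: (iterates_rv j).
Qed.

Let F_measurable k : (F k).-sigma.-measurable `<=` @measurable _ T.
Proof. exact/coord_preimages_measurable/history_rv. Qed.

Let FE_measurable k : (FE k).-sigma.-measurable `<=` @measurable _ T.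
Proof.
by apply: coord_preimages_measurable => X [/history_rv|->].
Qed.

Let F_nondecreasing k : (F k).-sigma.-measurable `<=` (F k.+1).-sigma.-measurable.
Proof.
by apply: coord_preimages_sub => X [j [jk hX]]; exists j; rewrite leqW.
Qed.

Let F_sub_FE k : (F k).-sigma.-measurable `<=` (FE k).-sigma.-measurable.
Proof. by apply: coord_preimages_sub => X; left. Qed.

Let z_adapted k : @random_vector _ (g_sigma_algebraType (F k)) R d (z k).
Proof. by apply: coord_preimages_random_vector; exists k; split=> //; left. Qed.

Let w_adapted k i : @random_vector _ (g_sigma_algebraType (F k)) R d (w k i).
Proof.
by apply: coord_preimages_random_vector; exists k; split=> //; right; left; exists i.
Qed.

Let wB_adapted k : @random_vector _ (g_sigma_algebraType (F k)) R d (wB k).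
Proof.
by apply: coord_preimages_random_vector; exists k; split=> //; right; right.
Qed.

Let lipschitz_rv {dS} {S : measurableType dS} (u : S -> 'rV[R]_d) :
  random_vector u -> random_vector (fun s => B (u s)).
Proof. by move=> mu; apply: (random_vector_lipschitz L u) => //; exact: ltW. Qed.

Let rvT k (u : T -> 'rV[R]_d) :
  @random_vector _ (g_sigma_algebraType (F k)) R d u -> random_vector u.
Proof. by move=> mu c; exact: (sub_sigma_measurable_fun (F k) (@F_measurable k)). Qed.

(** * The descent inequality integrated over events of the past *)

Section OneStep.
Variable p : 'rV[R]_d * ('I_n -> 'rV[R]_d).
Hypothesis p_sol : extended_solution A B p.

Definition energy k om := 1 + sqr_dist B p (z k om) (w k ^~ om) (wB k om).

Lemma energy_ge1 k om : 1 <= energy k om.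
Proof.
by rewrite lerDl; case: (sqr_dist_ge B p (z k om) (w k ^~ om) (wB k om)).
Qed.

Let energy_ge0 k om : 0 <= energy k om.
Proof. exact: le_trans (energy_ge1 k om). Qed.

Lemma energy_adapted k : measurable_fun [set: g_sigma_algebraType (F k)] (energy k).
Proof.
have mB (u : T -> 'rV[R]_d) (a : 'rV[R]_d) :
    @random_vector _ (g_sigma_algebraType (F k)) R d u ->
    measurable_fun [set: g_sigma_algebraType (F k)]
      (fun om => dotp (u om - a) (u om - a)).
  move=> mu; apply: measurable_dotp; apply: random_vectorB => //;
    exact: random_vector_cst.
apply: measurable_funD => //; apply: measurable_funD; last exact: mB.
apply: measurable_funD; first exact: mB.
by apply: measurable_sum => i; exact: (mB (w k i)).
Qed.

Lemma residual_ge0 k om : 0 <= residual k om.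
Proof.
rewrite /residual addr_ge0 ?dotp_ge0//.
exact: (sum_dotp_ge0 (fun i => z k om - x k i om)).
Qed.

(** Integrability propagates with the inequality: once [energy k] is integrable, so is the whole
    bound of [descent], and that bound dominates both [energy k.+1] and a positive multiple of the
    residual. *)
Lemma one_step : exists2 kappa, 0 < kappa & exists2 K, 0 <= K & forall k,
  P.-integrable setT (EFin \o energy k) ->
  [/\ P.-integrable setT (EFin \o energy k.+1),
      P.-integrable setT (EFin \o residual k) &
      forall D, (F k).-sigma.-measurable D ->
        \int[P]_(om in D) energy k.+1 om
          + 2 * kappa * (alpha k * rho k) * \int[P]_(om in D) residual k om <=
        (1 + K * (alpha k ^+ 2 + alpha k * rho k ^+ 2))
          * \int[P]_(om in D) energy k om].
Proof.
have [kappa kappa0 [C C0 hdesc]] := descent p p_sol.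
have [Cz Cz0 hz] := solution_growth p.
have [CB CB0 hB] := oracle_growth p.
(* [C1] and [C2] bound the second moments of eps and e by multiples of the energy, the constants
   [N1] and [N3] being absorbed since the energy is at least 1. The factor 1 + C1 in [C2] integrates
   energy plus |eps|^2. *)
pose C1 := N1 + N2 * Cz.
pose C2 := (N3 + N4 * CB) * (1 + C1).
have C10 : 0 <= C1 by rewrite addr_ge0// mulr_ge0.
have C20 : 0 <= C2 by rewrite mulr_ge0 ?addr_ge0// mulr_ge0.
(* The two summands are the coefficients of alpha_k^2 and of alpha_k rho_k^2 in a3 C1 + a4 C2 +
   a4. *)
pose K := C * (1 + C1 + C2) + 2 * L * C1.
have K0 : 0 <= K by rewrite addr_ge0// mulr_ge0 ?addr_ge0// mulr_ge0// ltW.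
exists kappa => //; exists K => // k iW.
have [mean_eps [mean_e [sq_eps sq_e]]] := noise k.
have [mz mw mwB] := iterates_rv k.
have mBz2 : measurable_fun setT (fun om => enorm (B (z k om)) ^+ 2).
  under eq_fun do rewrite sqr_enorm.
  by apply: measurable_dotp; exact: lipschitz_rv.
have mxB : random_vector (xB k).
  apply: random_vectorB => //; apply: random_vectorZ.
  by apply: random_vectorB => //; apply: random_vectorD => //; exact: lipschitz_rv.
have mBxB2 : measurable_fun setT (fun om => enorm (B (xB k om)) ^+ 2).
  under eq_fun do rewrite sqr_enorm.
  by apply: measurable_dotp; exact: lipschitz_rv.
have lin f g a D : measurable D -> P.-integrable setT (EFin \o f) ->
    P.-integrable setT (EFin \o g) ->
    P.-integrable setT (EFin \o (fun x => f x + a * g x)) /\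
    \int[P]_(x in D) (f x + a * g x) =
    \int[P]_(x in D) f x + a * \int[P]_(x in D) g x.
  exact: RintegralD_scale.
have iZ a f : P.-integrable setT (EFin \o f) ->
    P.-integrable setT (EFin \o (fun om => a * f om)).
  by move=> intf; exact: (integrableZl measurableT a intf).
have FT : (F k).-sigma.-measurable setT :=
  @measurableT _ (g_sigma_algebraType (F k)).
have sub_int f g D : measurable D -> P.-integrable setT (EFin \o f) ->
    P.-integrable setT (EFin \o g) -> (forall om, f om <= g om) ->
    \int[P]_(om in D) f om <= \int[P]_(om in D) g om.
  move=> mD intf intg fg.
  by apply: le_Rintegral => //; exact: (integrableS measurableT).
pose U1 om := N1 + N2 * enorm (B (z k om)) ^+ 2.
have mU1 : measurable_fun setT U1.
  by apply: measurable_funD => //; exact: measurable_funM.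
have U1_ge0 om : 0 <= U1 om by rewrite addr_ge0// mulr_ge0// sqr_ge0.
have U1_le om : U1 om <= C1 * energy k om.
  have h1 := ler_wpM2l N2_ge0 (hz k om); have h2 := ler_wpM2l N1_ge0 (energy_ge1 k om).
  rewrite /U1 /C1; rewrite -/(energy k om) in h1; lra.
have iU1 : P.-integrable setT (EFin \o U1).
  apply: (le_Rintegrable _ _ _ _ measurableT mU1 (iZ C1 _ iW)) => om _.
  by rewrite ger0_norm.
have eps_moment D : (F k).-sigma.-measurable D ->
    P.-integrable setT (EFin \o (fun om => dotp (eps k om) (eps k om))) /\
    \int[P]_(om in D) dotp (eps k om) (eps k om) <= C1 * \int[P]_(om in D) energy k om.
  move=> FD; have mD := F_measurable k _ FD.
  have [i_eps le_eps] := cond_sq_bound_integral P _ (eps k) U1 D (F_measurable k)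
    (eps_rv k) mU1 U1_ge0 sq_eps iU1 FT FD.
  split=> //; apply: le_trans le_eps _.
  rewrite -RintegralZl//; last exact: (integrableS measurableT).
  by apply: sub_int => //; exact: iZ.
have [i_eps _] := eps_moment _ FT.
pose U2 om := N3 + N4 * enorm (B (xB k om)) ^+ 2.
have mU2 : measurable_fun setT U2.
  by apply: measurable_funD => //; exact: measurable_funM.
have U2_ge0 om : 0 <= U2 om by rewrite addr_ge0// mulr_ge0// sqr_ge0.
pose G2 om := energy k om + 1 * dotp (eps k om) (eps k om).
have U2_le om : U2 om <= (N3 + N4 * CB) * G2 om.
  have h1 := ler_wpM2l N4_ge0 (hB k om); have h2 := ler_wpM2l N3_ge0 (energy_ge1 k om).
  have h3 := mulr_ge0 N3_ge0 (dotp_ge0 (eps k om)).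
  rewrite /U2 /G2 mul1r; rewrite -/(energy k om) in h1; lra.
have [iG2 _] := lin _ _ 1 setT measurableT iW i_eps.
have iU2 : P.-integrable setT (EFin \o U2).
  apply: (le_Rintegrable _ _ _ _ measurableT mU2 (iZ (N3 + N4 * CB) _ iG2)) => om _.
  by rewrite ger0_norm.
(* The bound on e involves xB, which depends on eps, and so is conditional on [FE k]. An event of
   [F k] belongs to [FE k]; the moment of eps then brings the estimate back to the energy. *)
have e_moment D : (F k).-sigma.-measurable D ->
    P.-integrable setT (EFin \o (fun om => dotp (e k om) (e k om))) /\
    \int[P]_(om in D) dotp (e k om) (e k om) <= C2 * \int[P]_(om in D) energy k om.
  move=> FD; have mD := F_measurable k _ FD.
  have [i_e le_e] := cond_sq_bound_integral P _ (e k) U2 D (FE_measurable k)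
    (e_rv k) mU2 U2_ge0 sq_e iU2 (F_sub_FE k _ FT) (F_sub_FE k _ FD).
  split=> //; apply: le_trans le_e _.
  apply: (@le_trans _ _ ((N3 + N4 * CB) * \int[P]_(om in D) G2 om)).
    rewrite -RintegralZl//; last exact: (integrableS measurableT).
    by apply: sub_int => //; exact: iZ.
  have [_ ->] := lin _ _ 1 D mD iW i_eps.
  have [_ h] := eps_moment D FD.
  have a0 : 0 <= N3 + N4 * CB by rewrite addr_ge0// mulr_ge0.
  rewrite /C2 -mulrA ler_wpM2l// mulrDl mul1r mul1r.
  by rewrite lerD2l.
have [i_e _] := e_moment _ FT.
have dist_le om : [/\ dotp (z k om - p.1) (z k om - p.1) <= energy k om &
    dotp (wB k om - B p.1) (wB k om - B p.1) <= energy k om].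
  have [h1 _ h2 _] := sqr_dist_ge B p (z k om) (w k ^~ om) (wB k om).
  by split; rewrite /energy; lra.
pose h1 om : 'rV[R]_d := B (z k om) - wB k om.
pose h2 om : 'rV[R]_d := z k om - p.1.
have ah1 : @random_vector _ (g_sigma_algebraType (F k)) R d h1.
  by apply: random_vectorB => //; exact: lipschitz_rv.
have ah2 : @random_vector _ (g_sigma_algebraType (F k)) R d h2.
  by apply: random_vectorB => //; exact: random_vector_cst.
have ih1 : P.-integrable setT (EFin \o (fun om => dotp (h1 om) (h1 om))).
  apply: (le_Rintegrable _ _ _ _ measurableT _ (iZ (2 * L ^+ 2 + 2) _ iW)).
    by apply: measurable_dotp; exact: rvT ah1.
  move=> om _; rewrite ger0_norm ?dotp_ge0//.
  have -> : h1 om = (B (z k om) - B p.1) + - (wB k om - B p.1).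
    by rewrite opprB addrA subrK.
  apply: le_trans (dotpDD_le _ _) _; rewrite dotpNl dotpNr opprK.
  have [d1 d2] := dist_le om.
  have := lipschitz_sqr L B (z k om) p.1 B_lip.
  have : L ^+ 2 * dotp (z k om - p.1) (z k om - p.1) <= L ^+ 2 * energy k om.
    by rewrite ler_wpM2l// sqr_ge0.
  lra.
have ih2 : P.-integrable setT (EFin \o (fun om => dotp (h2 om) (h2 om))).
  apply: (le_Rintegrable _ _ _ _ measurableT _ iW).
    by apply: measurable_dotp; exact: rvT ah2.
  by move=> om _; rewrite ger0_norm ?dotp_ge0//; case: (dist_le om).
have cross1 D := cond_mean_zero_dotp P (F k) (eps k) h1 D (F_measurable k)
  (eps_rv k) mean_eps ah1 i_eps ih1.
have cross2 D := cond_mean_zero_dotp P (F k) (e k) h2 D (F_measurable k)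
  (e_rv k) mean_e ah2 i_e ih2.
have [ic1 _] := cross1 setT FT.
have [ic2 _] := cross2 setT FT.
(* The bound of [descent], shaped as an iterated [f + a * g] to be integrated by [lin]. *)
pose a1 := - 2 * alpha k * (rho k - 2 * L * rho k ^+ 2).
pose a2 := - 2 * alpha k.
pose a3 := 2 * L * (alpha k * rho k ^+ 2) + C * alpha k ^+ 2.
pose a4 := C * alpha k ^+ 2.
pose g1 om := energy k om + a1 * dotp (eps k om) (h1 om).
pose g2 om := g1 om + a2 * dotp (e k om) (h2 om).
pose g3 om := g2 om + a3 * dotp (eps k om) (eps k om).
pose g4 om := g3 om + a4 * dotp (e k om) (e k om).
pose g5 om := g4 om + a4 * energy k om.
have [ig1 _] := lin _ _ a1 setT measurableT iW ic1.
have [ig2 _] := lin _ _ a2 setT measurableT ig1 ic2.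
have [ig3 _] := lin _ _ a3 setT measurableT ig2 i_eps.
have [ig4 _] := lin _ _ a4 setT measurableT ig3 i_e.
have [ig5 _] := lin _ _ a4 setT measurableT ig4 iW.
have ck0 : 0 < 2 * kappa * (alpha k * rho k) by rewrite !mulr_gt0.
have dom om : energy k.+1 om + 2 * kappa * (alpha k * rho k) * residual k om <= g5 om.
  have := hdesc k om; rewrite /noise_term -/(h1 om) -/(h2 om) -/a1.
  rewrite /g5 /g4 /g3 /g2 /g1 /a2 /a3 /a4 /energy /=.
  lra.
have iW' : P.-integrable setT (EFin \o energy k.+1).
  apply: (le_Rintegrable _ _ _ _ measurableT _ ig5).
    exact: (sub_sigma_measurable_fun _ (@F_measurable k.+1) _ (energy_adapted k.+1)).
  move=> om _; rewrite ger0_norm//; apply: le_trans (dom om).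
  by rewrite lerDl mulr_ge0 ?residual_ge0// ltW.
have mx := x_rv k mz mw.
have mres : measurable_fun setT (residual k).
  apply: measurable_funD.
    by apply: measurable_sum => i; apply: measurable_dotp; exact: random_vectorB.
  by apply: measurable_dotp; exact: rvT ah1.
have ires : P.-integrable setT (EFin \o residual k).
  apply: (le_Rintegrable _ _ _ _ measurableT mres
    (iZ (2 * kappa * (alpha k * rho k))^-1 _ ig5)) => om _.
  rewrite ger0_norm ?residual_ge0// ler_pdivlMl//.
  by apply: le_trans (dom om); rewrite lerDr.
split=> // D FD.
have mD := F_measurable k _ FD.
have [ilhs <-] := lin _ _ (2 * kappa * (alpha k * rho k)) D mD iW' ires.
apply: (le_trans (sub_int _ _ D mD ilhs ig5 dom)).
have [_ ->] := lin _ _ a4 D mD ig4 iW.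
have [_ ->] := lin _ _ a4 D mD ig3 i_e.
have [_ ->] := lin _ _ a3 D mD ig2 i_eps.
have [_ ->] := lin _ _ a2 D mD ig1 ic2.
have [_ ->] := lin _ _ a1 D mD iW ic1.
have [_ ->] := cross1 D FD; have [_ ->] := cross2 D FD.
have [_ he1] := eps_moment D FD; have [_ he2] := e_moment D FD.
have I0 : 0 <= \int[P]_(om in D) energy k om by exact: Rintegral_ge0.
move: he1 he2 I0.
move: (\int[P]_(om in D) dotp (eps k om) (eps k om))
  (\int[P]_(om in D) dotp (e k om) (e k om)) (\int[P]_(om in D) energy k om).
move=> Ieps Ie IW he1 he2 I0.
have a30 : 0 <= a3.
  by rewrite /a3 addr_ge0// !mulr_ge0 ?sqr_ge0// ltW.
have a40 : 0 <= a4 by rewrite mulr_ge0// sqr_ge0.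
have q1 : a3 * Ieps <= a3 * (C1 * IW) by rewrite ler_wpM2l.
have q2 : a4 * Ie <= a4 * (C2 * IW) by rewrite ler_wpM2l.
have t1 : 0 <= alpha k * rho k ^+ 2 by rewrite mulr_ge0 ?sqr_ge0// ltW.
have t2 := sqr_ge0 (alpha k).
have t3 : 0 <= 1 + C1 + C2 by rewrite addr_ge0// addr_ge0.
have q3 := mulr_ge0 (mulr_ge0 (mulr_ge0 C0 t3) t1) I0.
have L0 := ltW L_gt0.
have q4 := mulr_ge0 (mulr_ge0 (mulr_ge0 (mulr_ge0 (ler0n R 2) L0) C10) t2) I0.
apply: (@le_trans _ _ (IW + a3 * (C1 * IW) + a4 * (C2 * IW) + a4 * IW)).
  by rewrite !mulr0 !addr0; lra.
rewrite /a3 /a4 /K; lra.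
Qed.
End OneStep.

Hypothesis steps_summable : exists C, forall N,
  \sum_(0 <= k < N) (alpha k ^+ 2 + alpha k * rho k ^+ 2) <= C.
Hypothesis steps_unbounded : forall M, exists N,
  M < \sum_(0 <= k < N) alpha k * rho k.

Lemma energy_integrable p k : extended_solution A B p ->
  P.-integrable setT (EFin \o energy p k).
Proof.
move=> p_sol; have [kappa _ [K _ step]] := one_step p p_sol.
elim: k => [|k /step[]//].
rewrite (_ : energy p 0%N = cst (1 + sqr_dist B p z1 w1 wB1)).
  exact: finite_measure_integrable_cst.
apply/funext => om; rewrite /energy.
have [-> [w0 ->]] := init om; congr (1 + sqr_dist B p z1 _ wB1).
by apply/funext => i; exact: w0.
Qed.

Lemma energy_cvg_residual_small p : extended_solution A B p ->
  {ae P, forall om, cvgn (energy p ^~ om)} /\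
  {ae P, forall om, forall eta N, 0 < eta ->
    exists2 k, (N <= k)%N & residual k om < eta}.
Proof.
move=> p_sol; have [kappa kappa0 [K K0 step]] := one_step p p_sol.
have [Cb hCb] := steps_summable.
have iW k := energy_integrable p k p_sol.
have ires k : P.-integrable setT (EFin \o residual k) by case: (step k (iW k)).
pose b k := K * (alpha k ^+ 2 + alpha k * rho k ^+ 2).
pose c k := 2 * kappa * (alpha k * rho k).
have W0 k om : 0 <= energy p k om by exact: le_trans (energy_ge1 p k om).
have b0 k : 0 <= b k by rewrite mulr_ge0// addr_ge0 ?mulr_ge0 ?sqr_ge0// ltW.
have c0 k : 0 <= c k by rewrite !mulr_ge0// ltW.
have b_sum N : \sum_(0 <= k < N) b k <= K * Cb by rewrite -mulr_sumr ler_wpM2l.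
have hstep k D : (F k).-sigma.-measurable D ->
    \int[P]_(om in D) energy p k.+1 om + c k * \int[P]_(om in D) residual k om <=
    (1 + b k) * \int[P]_(om in D) energy p k om.
  by case: (step k (iW k)) => _ _; exact.
split.
  exact: (almost_supermartingale_cvg P F (energy p) residual b c (K * Cb)
    F_measurable F_nondecreasing (energy_adapted p) W0 residual_ge0 iW b0 c0 b_sum hstep).
apply: (residual_frequently_small P F (energy p) residual b c (K * Cb)
  W0 residual_ge0 ires b0 c0 b_sum hstep) => M.
have [N hN] := steps_unbounded (M / (2 * kappa)); exists N.
by rewrite -mulr_sumr mulrC -ltr_pdivrMr// mulr_gt0.
Qed.

Lemma sps_cvg p0 : extended_solution A B p0 ->
  {ae P, forall om, exists zs, cvg_vec (fun k => z k om) zs /\ is_zero_of_sum A B zs}.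
Proof.
move=> p0_sol.
have [s [s_sol s_dense]] := dense_solutions A B p0 p0_sol.
have cvg_all : {ae P, forall om, forall m, cvgn (energy (s m) ^~ om)}.
  apply: (@ae_foralln _ _ _ P (fun m om => cvgn (energy (s m) ^~ om))) => m.
  by case: (energy_cvg_residual_small _ (s_sol m)).
(* The residual does not involve the reference solution, so a single one suffices here. *)
have [_ small] := energy_cvg_residual_small _ p0_sol.
apply: filterS2 cvg_all small => om cvg_om small_om.
apply: (iterates_cvg A B L tau A_max B_lip tau_gt0 s s_dense
  (z ^~ om) (wB ^~ om) (fun k i => w k i om) (fun k i => x k i om)) => //.
move=> m.
rewrite (_ : (fun k => _) = (fun k => energy (s m) k om - 1)).
  by apply: is_cvgB => //; exact: is_cvg_cst.
by apply/funext => k; rewrite /energy addrC addKr.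
Qed.
End StochasticProjectiveSplitting.

Theorem theorem1
  (R : realType) (dT : measure_display) (T : measurableType dT)
  (P : probability T R)
  (n d : nat) (hn : (1 <= n)%N) (hd : (1 <= d)%N)
  (A : 'I_n -> 'rV[R]_d -> set 'rV[R]_d) (B : 'rV[R]_d -> 'rV[R]_d) (L : R)
  (hA : forall i, maximal_monotone (A i))
  (hBmon : monotone_fun B) (hL : 0 < L) (hBlip : lipschitz_with L B)
  (hsol : exists zs, is_zero_of_sum A B zs)
  (tau : R) (htau : 0 < tau)
  (alpha rho : nat -> R) (halpha : forall k, 0 < alpha k) (hrho : forall k, 0 < rho k)
  (N1 N2 N3 N4 rhobar : R)
  (hN1 : 0 <= N1) (hN2 : 0 <= N2) (hN3 : 0 <= N3) (hN4 : 0 <= N4)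
  (* the iterates p^k = (z^k, w_1^k, ..., w_n^k, w_{n+1}^k), k = 0, 1, 2, ... *)
  (z : nat -> T -> 'rV[R]_d) (w : nat -> 'I_n -> T -> 'rV[R]_d)
  (wB : nat -> T -> 'rV[R]_d)
  (* x_i^k = J_{tau A_i}(t_i^k), i = 1..n *)
  (x : nat -> 'I_n -> T -> 'rV[R]_d)
  (* noise of the stochastic oracle for B *)
  (eps e : nat -> T -> 'rV[R]_d)
  (heps_rv : forall k, random_vector (eps k)) (he_rv : forall k, random_vector (e k))
  (* deterministic initial point with sum of the w's equal to 0 *)
  (z1 : 'rV[R]_d) (w1 : 'I_n -> 'rV[R]_d) (wB1 : 'rV[R]_d)
  (hw1 : \sum_(i < n) w1 i + wB1 = 0)
  (hinit : forall om, z 0%N om = z1 /\ (forall i, w 0%N i om = w1 i) /\ wB 0%N om = wB1)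
  (* the SPS recursion *)
  (hx : forall k i om, resolvent_rel tau (A i) (z k om + tau *: w k i om) (x k i om))
  (hstep : forall k om,
     let y i := tau^-1 *: (z k om + tau *: w k i om - x k i om) in
     let xB := z k om - rho k *: (B (z k om) + eps k om - wB k om) in
     let yB := B xB + e k om in
     let xbar := (n.+1)%:R^-1 *: (\sum_(i < n) x k i om + xB) in
     z k.+1 om = z k om - alpha k *: (\sum_(i < n) y i + yB) /\
     (forall i, w k.+1 i om = w k i om - alpha k *: (x k i om - xbar)) /\
     wB k.+1 om = wB k om - alpha k *: (xB - xbar))
  (* noise assumptions; F k = sigma(p^0, ..., p^k), FE k = sigma(F k, eps^k) *)
  (hnoise :
     let Fgen k := [set X : T -> 'rV[R]_d | exists j, (j <= k)%N /\
                      (X = z j \/ (exists i, X = w j i) \/ X = wB j)] in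
     let F k := gen_sigma_vec (Fgen k) in
     let FE k := gen_sigma_vec (Fgen k `|` [set eps k]) in
     let xB k om := z k om - rho k *: (B (z k om) + eps k om - wB k om) in
     forall k,
       cond_mean_zero P (F k) (eps k) /\
       cond_mean_zero P (F k) (e k) /\
       cond_sq_bound P (F k) (eps k)
         (fun om => N1 + N2 * enorm (B (z k om)) ^+ 2) /\
       cond_sq_bound P (FE k) (e k)
         (fun om => N3 + N4 * enorm (B (xB k om)) ^+ 2))
  (* stepsize conditions *)
  (hs1 : (\sum_(k <oo) (alpha k * rho k)%:E = +oo)%E)
  (hs2 : (\sum_(k <oo) (alpha k ^+ 2)%:E < +oo)%E)
  (hs3 : (\sum_(k <oo) (alpha k * rho k ^+ 2)%:E < +oo)%E)
  (hrhobar : forall k, rho k <= rhobar) (hrhobarL : rhobar < L^-1) :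
  {ae P, forall om, exists zs : 'rV[R]_d,
      cvg_vec (fun k => z k om) zs /\ is_zero_of_sum A B zs}.
Proof.
have [zs [a [Aza Sa]]] := hsol.
have [C2 hC2] := nneseries_bounded _ (fun k => sqr_ge0 (alpha k)) hs2.
have [C3 hC3] := nneseries_bounded (fun k => alpha k * rho k ^+ 2)
  (fun k => mulr_ge0 (ltW (halpha k)) (sqr_ge0 (rho k))) hs3.
have steps_unbounded := nneseries_unbounded (fun k => alpha k * rho k)
  (fun k => mulr_ge0 (ltW (halpha k)) (ltW (hrho k))) hs1.
apply: (sps_cvg P A B L tau rhobar N1 N2 N3 N4 alpha rho hA hBmon hL hBlip htau
  halpha hrho hrhobar hrhobarL hN1 hN2 hN3 hN4 z w wB x eps e heps_rv he_rv
  z1 w1 wB1 hw1 hinit hx _ _ _ hnoise _ steps_unbounded (zs, a)) => //.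
- by move=> k om; case: (hstep k om).
- by move=> k i om; case: (hstep k om) => _ [].
- by move=> k om; case: (hstep k om) => _ [].
- exists (C2 + C3) => N; rewrite big_split/=; exact: lerD.
Qed.
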